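(* Let $G$ be a graph with $n$ vertices. Then $G$ is planar and $\alpha_{ir}(G)= 1$ if and only if $G$ is a regular planar graph or a copy of one of the graphs $K_{1,n-1}$, $K_{2,n-2}$, $K_2 + E_{n-2}$, $K_2 + \frac{n-2}{2} K_2$, $E_2 + \frac{n-2}{2} K_2$, $E_2 + C_{n-2}$, $Wd(3,\frac{n-1}{2})$, and $K_1+H$, where $H$ is a union of vertex-disjoint cycles (each graph in the list being considered only for those $n$ for which it is defined).
   Context: All graphs are finite, simple, undirected and have at least one vertex. An irregular independent set of $G$ is an independent set $A$ of $G$ such that any two distinct vertices in $A$ have different degrees in $G$; $\alpha_{ir}(G)$ is the size of a largest irregular independent set of $G$. ''A copy of'' means a graph isomorphic to. $K_r$, $E_r$ and $C_r$ (with $r \geq 3$ for $C_r$) denote the complete graph, the graph with no edges, and the cycle on $r$ vertices, respectively; $K_{p,q}$ is the complete bipartite graph with partite sets of sizes $p$ and $q$; $sK_2$ is the vertex-disjoint union of $s$ copies of $K_2$. For vertex-disjoint graphs $G$ and $H$, the join $G+H$ is the graph with $V(G+H)=V(G) \cup V(H)$ and $E(G+H)=E(G) \cup E(H) \cup \{ \{ x,y\} : x \in V(G), y\in V(H) \}$. For $k \geq 2$ and $r \geq 2$, the $k$-windmill graph $Wd(k,r)$ is $K_1 + H$, where $H$ is a vertex-disjoint union of $r$ copies of $K_{k-1}$. *)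

(* Defs.v *)
From HB Require Import structures.
From mathcomp Require Import all_boot all_order all_algebra.
From mathcomp Require Import all_classical all_reals all_analysis.
Import Order.TTheory GRing.Theory Num.Theory.
Import numFieldNormedType.Exports.

Set Implicit Arguments.
Unset Strict Implicit.
Unset Printing Implicit Defensive.

Local Open Scope nat_scope.

(* Simple graphs; an sgraph may be empty, so nonemptiness is a hypothesis
   wherever it matters. *)
Record sgraph := SGraph {
  vertex :> finType;
  adj : rel vertex;
  adj_sym : symmetric adj;
  adj_irr : irreflexive adj }.
Arguments adj {s} x y.

Definition isomorphic (G H : sgraph) : Prop :=
  exists f : G -> H, bijective f /\ forall x y, adj (f x) (f y) = adj x y.

Definition edges (G : sgraph) : {set {set G}} :=
  [set E | [exists x, exists y, adj x y && (E == [set x; y])]].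

Definition deg (G : sgraph) (x : G) : nat := #|[set y | adj x y]|.

Definition regular (G : sgraph) : Prop :=
  exists d : nat, forall x : G, deg x = d.

Definition independent (G : sgraph) (A : {set G}) : bool :=
  [forall x in A, forall y in A, ~~ adj x y].

Definition irregular_independent (G : sgraph) (A : {set G}) : bool :=
  independent A &&
  [forall x in A, forall y in A, (x != y) ==> (deg x != deg y)].

Definition alpha_ir (G : sgraph) : nat :=
  \max_(A : {set G} | irregular_independent A) #|A|.

Lemma complete_adj_sym r : symmetric (fun i j : 'I_r => i != j).
Proof. by move=> i j; rewrite eq_sym. Qed.
Lemma complete_adj_irr r : irreflexive (fun i j : 'I_r => i != j).
Proof. by move=> i; rewrite eqxx. Qed.
Definition complete (r : nat) : sgraph :=
  SGraph (@complete_adj_sym r) (@complete_adj_irr r).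

Lemma edgeless_adj_sym r : symmetric (fun _ _ : 'I_r => false).
Proof. by []. Qed.
Lemma edgeless_adj_irr r : irreflexive (fun _ _ : 'I_r => false).
Proof. by []. Qed.
Definition edgeless (r : nat) : sgraph :=
  SGraph (@edgeless_adj_sym r) (@edgeless_adj_irr r).

(* This is the r-cycle for r >= 3 only; the condition i != j matters only
   for r = 1, where ordS has a fixed point. *)
Definition cycle_adj r (i j : 'I_r) : bool :=
  (i != j) && ((ordS i == j) || (ordS j == i)).
Lemma cycle_adj_sym r : symmetric (@cycle_adj r).
Proof. by move=> i j; rewrite /cycle_adj eq_sym orbC. Qed.
Lemma cycle_adj_irr r : irreflexive (@cycle_adj r).
Proof. by move=> i; rewrite /cycle_adj eqxx. Qed.
Definition cycle_graph (r : nat) : sgraph :=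
  SGraph (@cycle_adj_sym r) (@cycle_adj_irr r).

Definition bipartite_adj p q (u v : 'I_p + 'I_q) : bool :=
  match u, v with
  | inl _, inr _ | inr _, inl _ => true
  | _, _ => false
  end.
Lemma bipartite_adj_sym p q : symmetric (@bipartite_adj p q).
Proof. by case=> [?|?] [?|?]. Qed.
Lemma bipartite_adj_irr p q : irreflexive (@bipartite_adj p q).
Proof. by case. Qed.
Definition complete_bipartite (p q : nat) : sgraph :=
  SGraph (@bipartite_adj_sym p q) (@bipartite_adj_irr p q).

Definition join_adj (G H : sgraph) (u v : G + H) : bool :=
  match u, v with
  | inl x, inl y => adj x y
  | inr x, inr y => adj x y
  | _, _ => true
  end.
Lemma join_adj_sym G H : symmetric (@join_adj G H).
Proof. by case=> [x|x] [y|y] //=; rewrite adj_sym. Qed.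
Lemma join_adj_irr G H : irreflexive (@join_adj G H).
Proof. by case=> x /=; rewrite adj_irr. Qed.
Definition graph_join (G H : sgraph) : sgraph :=
  SGraph (@join_adj_sym G H) (@join_adj_irr G H).

(* Vertex-disjoint union of a finite family: a vertex is a pair (i, x) with
   x in F i.  When the tags of u and v agree, tagged_as u v is the second
   component of v, cast to F (tag u). *)
Definition dunion_adj (I : finType) (F : I -> sgraph)
    (u v : {i : I & vertex (F i)}) : bool :=
  (tag u == tag v) && adj (tagged u) (tagged_as u v).
Lemma dunion_adj_sym I F : symmetric (@dunion_adj I F).
Proof.
move=> [i x] [j y]; rewrite /dunion_adj [tag _ == _]eq_sym.
case: (tag _ =P tag _) => //= eji; move: eji x y => /= -> x y.
have tagE (x' y' : F i) : tagged_as (existT (fun k => vertex (F k)) i x')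
    (existT (fun k => vertex (F k)) i y') = y' by exact: tagged_asE.
by rewrite !tagE adj_sym.
Qed.
Lemma dunion_adj_irr I F : irreflexive (@dunion_adj I F).
Proof.
move=> u; rewrite /dunion_adj.
have -> : tagged_as u u = tagged u by case: u => i x; exact: tagged_asE.
by rewrite adj_irr andbF.
Qed.
Definition disjoint_union (I : finType) (F : I -> sgraph) : sgraph :=
  SGraph (@dunion_adj_sym I F) (@dunion_adj_irr I F).

Definition copies (s : nat) (G : sgraph) : sgraph :=
  disjoint_union (fun _ : 'I_s => G).

Definition windmill (k r : nat) : sgraph :=
  graph_join (complete 1) (copies r (complete k.-1)).

Local Open Scope classical_set_scope.
Local Open Scope ring_scope.

(* A drawing of G in the plane: p places the vertices at distinct points, and
   each edge E is drawn as a simple arc arc E : [0, 1] -> R^2 joining its two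
   ends, whose interior contains no vertex and no point of any other edge. *)
Definition plane_drawing (R : realType) (G : sgraph)
    (p : G -> R * R) (arc : {set G} -> R -> R * R) : Prop :=
  [/\ injective p,
      forall E, E \in edges G ->
        [/\ {within `[0, 1], continuous (arc E)},
            {in `[0, 1] &, injective (arc E)} &
            [set arc E 0; arc E 1] = p @` [set` E]],
      forall E, E \in edges G ->
        forall (t : R) (x : G), t \in `]0, 1[ -> arc E t <> p x &
      forall E F, E \in edges G -> F \in edges G -> E != F ->
        forall s t : R, s \in `]0, 1[ -> t \in `[0, 1] -> arc E s <> arc F t].

Definition planar (R : realType) (G : sgraph) : Prop :=
  exists (p : G -> R * R) (arc : {set G} -> R -> R * R), plane_drawing p arc.

(* Main.v *)
(** The equality alpha_ir = 1 says that vertices of different degrees are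
    adjacent, so a non-regular G is the join of its degree classes. As K33 is not
    planar, one side A of such a join has one or two vertices and the other side
    H is regular, of degree d say. If d >= 3, a longest path of H yields a
    subdivided K4, hence a subdivided K5 in the join with one vertex; if d = 2,
    then H is a disjoint union of cycles, and two adjacent vertices joined to a
    cycle, or two vertices joined to two cycles, again contain a subdivided K5.

    For the nonplanarity of K5 and K33, each arc is replaced by a chain of points
    with steps much smaller than the distance between disjoint arcs. For an edge e
    and a point y, let C y e be the parity of the number of times e - y crosses
    the positive first axis. For disjoint edges e = xx' and f = yy',
    C y e + C y' e + C x f + C x' f is the number of the differences y - x, y' - x,
    y - x', y' - x' lying in the upper half plane, modulo 2. Summed over all pairs
    of disjoint edges of K5 or K33 this gives 0 = 1.

    Conversely all the graphs of the list have straight-line drawings: points on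
    the parabola y = x^2, one vertex far below it and one just above its apex. *)
Require Import Defs.
From HB Require Import structures.
From mathcomp Require Import all_boot all_order all_algebra.
From mathcomp Require Import all_classical all_reals all_analysis.
From mathcomp Require Import ring lra zify.
From Stdlib Require Btauto.
Import Order.TTheory GRing.Theory Num.Theory.
Import numFieldNormedType.Exports.

Set Implicit Arguments.
Unset Strict Implicit.
Unset Printing Implicit Defensive.

Local Open Scope nat_scope.

(** * Crossing parities of discrete drawings *)

Lemma xorbE (b c : bool) : b (+) c = xorb b c.
Proof. by case: b c => [] []. Qed.

(** Deduces one parity identity from two others: the last premise becomes a Boolean identity that
    [xor_tauto] decides. *)
Lemma addb_eq2 (x1 y1 x2 y2 x y : bool) : x1 = y1 -> x2 = y2 ->
  x (+) (x1 (+) x2) = y (+) (y1 (+) y2) -> x = y.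
Proof. by move=> -> ->; exact: addIb. Qed.

Ltac xor_tauto := rewrite ?xorbE; Btauto.btauto.

Section CrossingParity.
Local Open Scope ring_scope.
Variable (R : realFieldType).
Implicit Types (d : R) (a b v w : R * R) (s t : seq (R * R)).

Definition nearby d a b : bool := (`|a.1 - b.1| < d) && (`|a.2 - b.2| < d).

(** The positive half of the first axis is included and the negative half is not, so that of v and
    -v exactly one is upper when v is nonzero. *)
Definition upper v : bool := (0 < v.2) || (v.2 == 0) && (0 < v.1).

(* A step short compared with its distance to the origin can only change [upper]
   far from the second axis, so testing the side of v alone is enough. *)
Definition cross v w : bool := (upper v (+) upper w) && (0 < v.1).

Fixpoint crossings b a s : bool :=
  if s is a' :: s' then cross (a - b) (a' - b) (+) crossings b a' s' else false.

Lemma upperN v : v != 0 -> upper (- v) = ~~ upper v.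
Proof.
case: v => v1 v2; rewrite /upper /= oppr_gt0 oppr_eq0 => nz.
case: (ltgtP v2 0) => //= v20; rewrite oppr_gt0; case: (ltgtP v1 0) => //= v10.
by case/eqP: nz; rewrite v10 v20.
Qed.

Lemma upper_sub a b : a != b -> upper (a - b) = ~~ upper (b - a).
Proof. by move=> ab; rewrite -opprB upperN // subr_eq0 eq_sym. Qed.

(** The four differences are close to each other compared with their distance from the origin. If
    they are far from the first axis, [upper] is constant on them and all terms cancel. Otherwise
    they lie on one side of the second axis, so only the crossings of the differences b - a or only
    those of a - b count; either kind sums to the right-hand side, as [upper] is negated by a change
    of sign. *)
Lemma crossings_square d a a' b b' : nearby d a a' -> nearby d b b' ->
  ~~ nearby (4 * d) a b -> ~~ nearby (4 * d) a b' ->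
  ~~ nearby (4 * d) a' b -> ~~ nearby (4 * d) a' b' ->
  cross (a - b) (a' - b) (+) cross (a - b') (a' - b')
    (+) (cross (b - a) (b' - a) (+) cross (b - a') (b' - a')) =
  upper (b - a) (+) upper (b' - a) (+) (upper (b - a') (+) upper (b' - a')).
Proof.
case: a a' b b' => [a1 a2] [a1' a2'] [b1 b2] [b1' b2'].
rewrite /nearby /= !ltr_norml => /andP[/andP[? ?] /andP[? ?]].
move=> /andP[/andP[? ?] /andP[? ?]] f1 f2 f3 f4.
have neq x1 x2 y1 y2 : ~~ ((- (4 * d) < x1 - y1 < 4 * d) && (- (4 * d) < x2 - y2 < 4 * d)) ->
  (x1, x2) != (y1, y2) :> R * R.
  by clear f1 f2 f3 f4; apply: contra => /eqP[-> ->]; lra.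
rewrite /cross (upper_sub (neq _ _ _ _ f1)) (upper_sub (neq _ _ _ _ f2)).
rewrite (upper_sub (neq _ _ _ _ f3)) (upper_sub (neq _ _ _ _ f4)) /=.
have [h|h] := lerP (2 * d) (b2 - a2).
  have [-> -> -> ->] : [/\ upper ((b1, b2) - (a1, a2)), upper ((b1', b2') - (a1, a2)),
     upper ((b1, b2) - (a1', a2')) & upper ((b1', b2') - (a1', a2'))].
    by clear f1 f2 f3 f4; rewrite /upper /=; split; apply/orP; left; lra.
  by [].
have [h'|h'] := lerP (b2 - a2) (- (2 * d)).
  have up x1 x2 : x2 < 0 -> upper (x1, x2) = false.
    by rewrite /upper /=; case: ltgtP.
  by clear f1 f2 f3 f4; rewrite !up //= ; lra.
have far x1 x2 y1 y2 : - (4 * d) < x2 - y2 -> x2 - y2 < 4 * d ->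
    ~~ ((- (4 * d) < x1 - y1 < 4 * d) && (- (4 * d) < x2 - y2 < 4 * d)) ->
    x1 - y1 <= - (4 * d) \/ 4 * d <= x1 - y1.
  by move=> -> ->; rewrite /= andbT negb_and -!leNgt => /orP.
have [l1 l2 l3] : [/\ - (4 * d) < a2 - b2, - (4 * d) < a2 - b2' & - (4 * d) < a2' - b2].
  by clear f1 f2 f3 f4; split; lra.
have [r1 r2 r3] : [/\ a2 - b2 < 4 * d, a2 - b2' < 4 * d & a2' - b2 < 4 * d].
  by clear f1 f2 f3 f4; split; lra.
have {f4 neq} := far _ _ _ _ l1 r1 f1; have := far _ _ _ _ l2 r2 f2; have := far _ _ _ _ l3 r3 f3.
clear far f1 f2 f3 l1 l2 l3 r1 r2 r3 h h' => g3 g2 g1.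
have [h1|h1] := lerP 0 (b1 - a1).
  have {}g1 : 4 * d <= b1 - a1 by case: g1 => ?; lra.
  have -> : 0 < b1 - a1 by lra.
  have -> : 0 < b1 - a1' by lra.
  have -> : 0 < a1 - b1 = false by lra.
  have -> : 0 < a1 - b1' = false by lra.
  by rewrite !andbT !andbF.
have {}g1 : b1 - a1 <= - (4 * d) by case: g1 => ?; lra.
have -> : 0 < b1 - a1 = false by lra.
have -> : 0 < b1 - a1' = false by lra.
have -> : 0 < a1 - b1 by lra.
have -> : 0 < a1 - b1' by lra.
rewrite !andbT !andbF.
move: (upper ((b1, b2) - (a1, a2))) (upper ((b1', b2') - (a1, a2))) => u1 u2.
move: (upper ((b1, b2) - (a1', a2'))) (upper ((b1', b2') - (a1', a2'))) => u3 u4.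
by case: u1 u2 u3 u4 => [] [] [] [].
Qed.

(* Summing [crossings_square] over the grid of two chains that stay apart. *)
Lemma crossings_step d a a' b t :
  nearby d a a' -> path (nearby d) b t ->
  (forall y, y \in b :: t -> ~~ nearby (4 * d) a y /\ ~~ nearby (4 * d) a' y) ->
  cross (a - b) (a' - b) (+) cross (a - last b t) (a' - last b t)
    (+) (crossings a b t (+) crossings a' b t) =
  upper (b - a) (+) upper (last b t - a)
    (+) (upper (b - a') (+) upper (last b t - a')).
Proof.
move=> aa'; elim: t b => [|b' t IH] b; first by rewrite /= !addbb.
move=> /= /andP[bb' b't] far.
have [f1 f2] : ~~ nearby (4 * d) a b /\ ~~ nearby (4 * d) a' b.
  by apply: far; rewrite mem_head.
have [f3 f4] : ~~ nearby (4 * d) a b' /\ ~~ nearby (4 * d) a' b'.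
  by apply: far; rewrite !inE eqxx orbT.
apply: addb_eq2 (crossings_square aa' bb' f1 f3 f2 f4) (IH b' b't _) _.
  by move=> y yt; apply: far; rewrite inE yt orbT.
by xor_tauto.
Qed.

Lemma crossings_grid d a b s t : path (nearby d) a s -> path (nearby d) b t ->
  (forall x y, x \in a :: s -> y \in b :: t -> ~~ nearby (4 * d) x y) ->
  crossings b a s (+) crossings (last b t) a s
    (+) (crossings a b t (+) crossings (last a s) b t) =
  upper (b - a) (+) upper (last b t - a)
    (+) (upper (b - last a s) (+) upper (last b t - last a s)).
Proof.
elim: s a => [|a' s IH] a; first by rewrite /= !addbb.
move=> /= /andP[aa' a's] bt far.
have far0 y : y \in b :: t -> ~~ nearby (4 * d) a y /\ ~~ nearby (4 * d) a' y.
  by move=> yt; split; apply: far; rewrite // !inE eqxx ?orbT.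
apply: addb_eq2 (crossings_step aa' bt far0) (IH a' a's bt _) _.
  by move=> x y xs; apply: far; rewrite inE xs orbT.
by xor_tauto.
Qed.

Definition apart d s t := forall x y, x \in s -> y \in t -> ~~ nearby (4 * d) x y.

(* Only edges without a common end are required to be drawn apart. *)
Definition chain_drawing d n (E : rel nat) (q : nat -> R * R)
    (e : nat -> nat -> seq (R * R)) : Prop :=
  [/\ forall i j, (i < j < n)%N -> q i != q j,
      forall i j, E i j -> path (nearby d) (q i) (e i j) /\ last (q i) (e i j) = q j &
      forall i j k l, E i j -> E k l -> uniq [:: i; j; k; l] ->
        apart d (q i :: e i j) (q k :: e k l)].

(** What remains of a drawing once the geometry is forgotten: [C k i j] stands for the crossings of
    the edge ij seen from k, and [U i j] tells whether point i minus point j is upper. *)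
Definition parity_system n (E : rel nat) (C : nat -> nat -> nat -> bool)
    (U : rel nat) : Prop :=
  (forall i j, (i < j < n)%N -> U j i = ~~ U i j) /\
  (forall i j k l, [&& E i j, E k l & uniq [:: i; j; k; l]] ->
    C k i j (+) C l i j (+) (C i k l (+) C j k l) =
    U k i (+) U l i (+) (U k j (+) U l j)).

Lemma chain_drawing_parity d n E q e : chain_drawing d n E q e ->
  parity_system n E (fun k i j => crossings (q k) (q i) (e i j))
    (fun i j => upper (q i - q j)).
Proof.
move=> [qI eP far]; split=> [i j ij|i j k l /and3P[Eij Ekl U]].
  by rewrite upper_sub // eq_sym qI.
have [[pij lij] [pkl lkl]] := (eP _ _ Eij, eP _ _ Ekl).
by have := crossings_grid pij pkl (far _ _ _ _ Eij Ekl U); rewrite lij lkl.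
Qed.
End CrossingParity.

Definition K5_edge (i j : nat) : bool := i < j < 5.

Definition K33_edge (i j : nat) : bool := (i < 3 <= j) && (j < 6).

(* In the sum over all pairs of independent edges each value of [C] occurs twice
   and each [U i j] an even number of times. *)
Lemma K5_parity C U : ~ parity_system 5 K5_edge C U.
Proof.
case=> A P.
have H := P 0 1 2 3 isT.
have {}H := congr2 addb H (P 0 1 2 4 isT).
have {}H := congr2 addb H (P 0 1 3 4 isT).
have {}H := congr2 addb H (P 0 2 1 3 isT).
have {}H := congr2 addb H (P 0 2 1 4 isT).
have {}H := congr2 addb H (P 0 2 3 4 isT).
have {}H := congr2 addb H (P 0 3 1 2 isT).
have {}H := congr2 addb H (P 0 3 1 4 isT).
have {}H := congr2 addb H (P 0 3 2 4 isT).
have {}H := congr2 addb H (P 0 4 1 2 isT).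
have {}H := congr2 addb H (P 0 4 1 3 isT).
have {}H := congr2 addb H (P 0 4 2 3 isT).
have {}H := congr2 addb H (P 1 2 3 4 isT).
have {}H := congr2 addb H (P 1 3 2 4 isT).
have {}H := congr2 addb H (P 1 4 2 3 isT).
(* An odd number of the occurrences of [U] have the larger index first. Turning them round leaves an
   odd number of negations, so the right-hand side is true while the left-hand side is false. *)
move: H; rewrite ?(A 0 1 isT) ?(A 0 2 isT) ?(A 0 3 isT) ?(A 0 4 isT) ?(A 1 2 isT) ?(A 1 3 isT) ?(A 1 4 isT) ?(A 2 3 isT) ?(A 2 4 isT) ?(A 3 4 isT) => H.
have : false = true by apply: etrans (etrans H _); xor_tauto.
by [].
Qed.

Lemma K33_parity C U : ~ parity_system 6 K33_edge C U.
Proof.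
case=> A P.
have H := P 0 3 1 4 isT.
have {}H := congr2 addb H (P 0 3 1 5 isT).
have {}H := congr2 addb H (P 0 3 2 4 isT).
have {}H := congr2 addb H (P 0 3 2 5 isT).
have {}H := congr2 addb H (P 0 4 1 3 isT).
have {}H := congr2 addb H (P 0 4 1 5 isT).
have {}H := congr2 addb H (P 0 4 2 3 isT).
have {}H := congr2 addb H (P 0 4 2 5 isT).
have {}H := congr2 addb H (P 0 5 1 3 isT).
have {}H := congr2 addb H (P 0 5 1 4 isT).
have {}H := congr2 addb H (P 0 5 2 3 isT).
have {}H := congr2 addb H (P 0 5 2 4 isT).
have {}H := congr2 addb H (P 1 3 2 4 isT).
have {}H := congr2 addb H (P 1 3 2 5 isT).
have {}H := congr2 addb H (P 1 4 2 3 isT).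
have {}H := congr2 addb H (P 1 4 2 5 isT).
have {}H := congr2 addb H (P 1 5 2 3 isT).
have {}H := congr2 addb H (P 1 5 2 4 isT).
move: H; rewrite ?(A 0 1 isT) ?(A 0 2 isT) ?(A 0 3 isT) ?(A 0 4 isT) ?(A 0 5 isT) ?(A 1 2 isT) ?(A 1 3 isT) ?(A 1 4 isT) ?(A 1 5 isT) ?(A 2 3 isT) ?(A 2 4 isT) ?(A 2 5 isT) ?(A 3 4 isT) ?(A 3 5 isT) ?(A 4 5 isT) => H.
have : false = true by apply: etrans (etrans H _); xor_tauto.
by [].
Qed.

(** * Discretisation of plane drawings *)

Section Discretisation.
Local Open Scope classical_set_scope.
Local Open Scope ring_scope.
Variable R : realType.
Implicit Types f g : R -> R * R.

Lemma nearbyE d (a b : R * R) : nearby d a b = (`|a - b| < d).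
Proof. by rewrite prod_normE /= gt_max. Qed.

Lemma path_unif_continuous f e : {within `[0, 1], continuous f} -> 0 < e ->
  exists2 r, 0 < r & {in `[0, 1] &, forall s t, `|s - t| < r -> nearby e (f s) (f t)}.
Proof.
move=> /subspace_continuousP fc e0.
have /compact_near_coveringP cov := @segment_compact R 0 1.
(* The radius r runs through the filter of positive numbers tending to 0, so that compactness turns
   the radii found around each point into a common one. *)
have := cov R (0 : R)^'+ (fun r s => forall t, t \in `[0, 1] ->
  `|s - t| < r -> s \in `[0, 1] -> nearby e (f s) (f t)) _.
case => [x x01|r /= r0 H].
  have /cvgrPdist_lt/(_ (e / 2)) := fc _ x01.
  rewrite divr_gt0 // => /(_ isT).
  rewrite near_withinE => /nbhs_ballP[r /= r0 xr].
  near=> s r' => /= t t01 st s01.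
  have xs : ball x (r / 2) s.
    by near: s; apply: nbhsx_ballx; rewrite divr_gt0.
  have r'r : r' < r / 2 by near: r'; apply: nbhs_right_lt; rewrite divr_gt0.
  move: xs; rewrite /ball /= => xs.
  have fs : `|f x - f s| < e / 2.
    apply: xr => //; rewrite /ball /=; apply: lt_trans xs _; lra.
  have ft : `|f x - f t| < e / 2.
    apply: xr => //; rewrite /ball /= (le_lt_trans (ler_distD s _ _)) //; lra.
  rewrite nearbyE (splitr e) (le_lt_trans (ler_distD (f x) _ _)) // ltrD //.
  by rewrite distrC.
have r2 : r / 2 < r by lra.
have r20 : 0 < r / 2 by rewrite divr_gt0.
exists (r / 2) => // s t s01 t01 st.
apply: (H (r / 2) _ r20 s) => //=.
by rewrite sub0r normrN gtr0_norm.
Unshelve. all: by end_near. Qed.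

Lemma path_chain f e : {within `[0, 1], continuous f} -> 0 < e ->
  exists s, [/\ path (nearby e) (f 0) s, last (f 0) s = f 1 &
    forall z, z \in s -> exists2 t, t \in `[0, 1] & z = f t].
Proof.
move=> fc e0; have [r r0 fr] := path_unif_continuous fc e0.
pose N := (Num.truncn r^-1).+1.
have N0 : 0 < N%:R :> R by rewrite ltr0n.
have rN : N%:R^-1 < r.
  by rewrite invf_plt ?posrE // truncnS_gt.
pose g k := f (k%:R / N%:R).
have I k : (k <= N)%N -> k%:R / N%:R \in `[0 : R, 1].
  by move=> kN; rewrite in_itv /= divr_ge0 //= ler_pdivrMr // mul1r ler_nat.
have gp m : (m <= N)%N -> path (nearby e) (g 0%N) [seq g k | k <- iota 1 m] /\ last (g 0%N) [seq g k | k <- iota 1 m] = g m.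
  elim: m => // m IH mN; have [p l] := IH (ltnW mN).
  rewrite -(addn1 m) iotaD map_cat cat_path last_cat p l add1n /= andbT addn1; split=> //.
  apply: fr; rewrite ?I //; first exact: ltnW.
  by rewrite -mulrBl -natr1 opprD addNKr mulN1r normrN gtr0_norm ?invr_gt0.
exists [seq g k | k <- iota 1 N].
have g0 : g 0%N = f 0 by rewrite /g mul0r.
have gN : g N = f 1 by rewrite /g divff // gt_eqF.
have [p l] := gp N (leqnn N); rewrite -g0 -gN; split=> // z /mapP[k].
by rewrite mem_iota add1n => /andP[_ kN] ->; exists (k%:R / N%:R) => //; apply: I.
Qed.

(** The distance attains its minimum on the product of the two compact images, and this minimum is
    positive. *)
Lemma disjoint_paths_apart f g :
  {within `[0, 1], continuous f} -> {within `[0, 1], continuous g} ->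
  {in `[0, 1] &, forall s t, f s <> g t} ->
  exists2 d, 0 < d & {in `[0, 1] &, forall s t, ~~ nearby d (f s) (g t)}.
Proof.
move=> fc gc fg; have I0 : (0 : R) \in `[0, 1] by rewrite in_itv /= lexx ler01.
have c01 := @segment_compact R 0 1.
pose K := (f @` `[0, 1]) `*` (g @` `[0, 1]).
have Kc : compact K by apply: compact_setX; apply: continuous_compact.
have K0 : K !=set0.
  by exists (f 0, g 0); split; exists 0.
have dc : {within K, continuous (fun z : (R * R) * (R * R) => `|z.1 - z.2|)}.
  apply: continuous_subspaceT => z; apply: cvg_norm.
  by apply: cvgB; [exact: cvg_fst|exact: cvg_snd].
have [[_ _] /set_mem[[s s01 <-] [t t01 <-]] m] := compact_EVT_min K0 Kc dc.
exists `|f s - g t|.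
  by rewrite normr_gt0 subr_eq0; apply/eqP/fg.
move=> s' t' s01' t01'; rewrite nearbyE -leNgt.
by apply: (m (f s', g t')); apply/mem_set; split; [exists s'|exists t'].
Qed.

Lemma within_itv_continuous_flip f : {within `[0, 1], continuous f} ->
  {within `[0, 1], continuous (fun t => f (1 - t))}.
Proof.
move=> fc; apply/subspace_continuousP => x /= x01.
have x01' : 1 - x \in `[0, 1] by move: x01; rewrite !in_itv /=; lra.
have /subspace_continuousP/(_ _ x01')/cvgrPdist_lt H := fc.
apply/cvgrPdist_lt => e /H; rewrite !near_withinE => /nbhs_ballP[r /= r0 xr].
apply/nbhs_ballP; exists r => //= t xt t01; apply: xr.
  move: xt; rewrite /ball /= (_ : 1 - x - (1 - t) = t - x) 1?distrC //; lra.
by move: t01; rewrite /= !in_itv /=; lra.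
Qed.

Lemma mem_edges (G : sgraph) (x y : G) : adj x y -> [set x; y]%SET \in edges G.
Proof.
by move=> xy; rewrite inE; apply/existsP; exists x; apply/existsP; exists y; rewrite xy eqxx.
Qed.

Section Drawing.
Variables (G : sgraph) (p : G -> R * R) (arc : {set G} -> R -> R * R).
Hypothesis D : plane_drawing p arc.

Lemma drawing_arc_ends x y : adj x y ->
  (arc [set x; y]%SET 0 = p x /\ arc [set x; y]%SET 1 = p y) \/
  (arc [set x; y]%SET 0 = p y /\ arc [set x; y]%SET 1 = p x).
Proof.
move=> xy; case: D => pI /(_ _ (mem_edges xy))[_ aI ends] _ _.
set E := [set x; y]%SET in aI ends *.
have H z : z \in E -> arc E 0 = p z \/ arc E 1 = p z.
  move=> zE; have : (p @` [set` E]) (p z) by exists z.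
  by rewrite -ends => -[] ->; [left|right].
have [x0|x1] := H x (set21 x y); have [y0|y1] := H y (set22 x y); first 1 last.
- by left.
- by right.
- have := adj_irr x; rewrite {2}(pI x y) ?xy //; congruence.
- have := adj_irr x; rewrite {2}(pI x y) ?xy //; congruence.
Qed.

(** An edge is an unordered pair and its arc may run in either direction; if necessary the arc is
    reversed. *)
Lemma drawing_dart x y : adj x y -> exists f,
  [/\ {within `[0, 1], continuous f}, f 0 = p x, f 1 = p y &
    forall t, t \in `[0, 1] -> exists2 t', t' \in `[0, 1] & f t = arc [set x; y]%SET t'].
Proof.
move=> xy; case: (D) => pI /(_ _ (mem_edges xy))[ac _ _] _ _.
have [[a0 a1]|[a0 a1]] := drawing_arc_ends xy.
  by exists (arc [set x; y]%SET); split=> // t t01; exists t.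
exists (fun t => arc [set x; y]%SET (1 - t)).
split; rewrite ?subr0 ?subrr //; first exact: within_itv_continuous_flip.
move=> t t01; exists (1 - t) => //.
by move: t01; rewrite !in_itv /=; lra.
Qed.

(** An inner point of an arc is neither a vertex nor a point of another edge, so the arcs could meet
    only at ends of both, and these are images of distinct vertices. *)
Lemma drawing_arcs_disjoint x y u v s t : adj x y -> adj u v ->
  uniq [:: x; y; u; v] -> s \in `[0, 1] -> t \in `[0, 1] ->
  arc [set x; y]%SET s <> arc [set u; v]%SET t.
Proof.
move=> xy uv U s01 t01; case: (D) => pI _ pv cr.
have EF : [set x; y]%SET != [set u; v]%SET.
  apply/eqP => /setP/(_ x); rewrite !inE eqxx /= => /esym.
  by move: U; rewrite /= !inE !negb_or => /and4P[/and3P[_ /negPf-> /negPf->]].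
have itv01 (r : R) : r \in `[0, 1] -> [\/ r = 0, r = 1 | r \in `]0, 1[].
  rewrite !in_itv /= => /andP[]; rewrite le_eqVlt eq_sym => /orP[/eqP|r0]; first by constructor 1.
  by rewrite le_eqVlt => /orP[/eqP|r1]; [constructor 2|constructor 3; rewrite r0 r1].
have ends (r : R) a b : adj a b -> r = 0 \/ r = 1 ->
    exists2 z, z \in [:: a; b] & arc [set a; b]%SET r = p z.
  move=> ab r01; have [[a0 a1]|[a0 a1]] := drawing_arc_ends ab.
    by case: r01 => ->; [exists a|exists b]; rewrite // !inE eqxx ?orbT.
  by case: r01 => ->; [exists b|exists a]; rewrite // !inE eqxx ?orbT.
have [s'|s']: (s = 0 \/ s = 1) \/ s \in `]0, 1[ by case: (itv01 _ s01); tauto.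
  have [z zE ->] := ends s x y xy s'.
  have [t'|t']: (t = 0 \/ t = 1) \/ t \in `]0, 1[ by case: (itv01 _ t01); tauto.
    have [w wF ->] := ends t u v uv t' => /pI zw.
    move: U zE wF; rewrite -[[:: x; y; u; v]]/([:: x; y] ++ [:: u; v]) cat_uniq.
    move=> /and3P[_ /hasPn U _] zE wF.
    by have := U _ wF; rewrite -zw zE.
  by move/esym; apply: pv => //; exact: mem_edges.
by apply: cr => //; exact: mem_edges.
Qed.
End Drawing.

Lemma planar_chains (G : sgraph) : planar R G ->
  exists (p : G -> R * R) d (c : G -> G -> seq (R * R)),
  [/\ injective p, 0 < d,
    forall x y, adj x y -> path (nearby d) (p x) (c x y) /\ last (p x) (c x y) = p y &
    forall x y u v, adj x y -> adj u v -> uniq [:: x; y; u; v] ->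
      apart d (p x :: c x y) (p u :: c u v)].
Proof.
move=> [p [arc D]]; exists p; have [pI _ _ _] := D.
have /choice[F FP] : forall z : G * G, exists f, adj z.1 z.2 ->
    [/\ {within `[0, 1], continuous f}, f 0 = p z.1, f 1 = p z.2 &
    forall t, t \in `[0, 1] -> exists2 t', t' \in `[0, 1] &
      f t = arc [set z.1; z.2]%SET t'].
  case=> x y /=; have [xy|xy] := boolP (adj x y); last by exists (fun=> 0).
  by have [f fP] := drawing_dart D xy; exists f.
have /choice[e eP] : forall z : (G * G) * (G * G), exists d, 0 < d /\
    (adj z.1.1 z.1.2 -> adj z.2.1 z.2.2 ->
     uniq [:: z.1.1; z.1.2; z.2.1; z.2.2] ->
    {in `[0, 1] &, forall s t, ~~ nearby d (F z.1 s) (F z.2 t)}).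
  case=> z w /=; have [zz|] := boolP (adj z.1 z.2); last by exists 1.
  have [ww|] := boolP (adj w.1 w.2); last by exists 1.
  have [U|] := boolP (uniq [:: z.1; z.2; w.1; w.2]); last by move=> /negP nU; exists 1; split=> // _ _ /nU.
  have [Fz Fz0 Fz1 Fza] := FP _ zz; have [Fw Fw0 Fw1 Fwa] := FP _ ww.
  have [|d d0 dP] := disjoint_paths_apart Fz Fw; last by exists d.
  move=> s t /Fza[s' s01 ->] /Fwa[t' t01 ->].
  exact: (drawing_arcs_disjoint D zz ww U).
(* A quarter of the least separation over all pairs of edges, because [apart d] speaks of the
   distance [4 * d]. *)
pose d := \big[Num.min/1]_z e z / 4.
have d0 : 0 < d.
  rewrite divr_gt0 //; elim/big_ind: _ => // [a b a0 b0|z _].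
    by rewrite lt_min a0 b0.
  by case: (eP z).
have dle z : 4 * d <= e z by rewrite mulrC divfK ?pnatr_eq0 // bigmin_le.
exists d.
have /choice[c cP] : forall z : G * G, exists c, adj z.1 z.2 ->
   [/\ path (nearby d) (p z.1) c, last (p z.1) c = p z.2 &
     forall a, a \in c -> exists2 t, t \in `[0, 1] & a = F z t].
  move=> z; have [zz|] := boolP (adj z.1 z.2); last by exists nil.
  have [Fz Fz0 Fz1 _] := FP _ zz.
  by have [c] := path_chain Fz d0; rewrite Fz0 Fz1 => ?; exists c.
exists (fun x y => c (x, y)); split=> // x y.
  by move=> /(cP (x, y))[].
move=> u v xy uv U a b.
have on z w : adj z w -> forall a, a \in p z :: c (z, w) -> exists2 t, t \in `[0, 1] & a = F (z, w) t.
  move=> zw {}a; rewrite inE => /orP[/eqP->|]; last by case: (cP (z, w) zw) => _ _; apply.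
  by exists 0; [rewrite in_itv /= lexx ler01|case: (FP (z, w) zw)].
move=> /(on _ _ xy _)[s s01 ->] /(on _ _ uv _)[t t01 ->].
have [_ /(_ xy uv U)/(_ _ _ s01 t01)] := eP ((x, y), (u, v)).
by apply: contra; rewrite !nearbyE => /lt_le_trans; apply; exact: dle.
Qed.

Fixpoint concat_chains (G : sgraph) (c : G -> G -> seq (R * R)) x w :=
  if w is y :: w' then c x y ++ concat_chains c y w' else [::].

Lemma concat_chains_path (G : sgraph) (p : G -> R * R) d c x w :
  (forall x y, adj x y -> path (nearby d) (p x) (c x y) /\ last (p x) (c x y) = p y) ->
  path adj x w -> path (nearby d) (p x) (concat_chains c x w) /\
    last (p x) (concat_chains c x w) = p (last x w).
Proof.
move=> cP; elim: w x => //= y w IH x /andP[/cP[pxy lxy] /IH[pyw lyw]].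
by rewrite cat_path last_cat lxy pxy.
Qed.

Lemma mem_concat_chains (G : sgraph) (p : G -> R * R) c x w z :
  path adj x w -> w != [::] -> z \in p x :: concat_chains c x w ->
  exists u v, [/\ u \in x :: w, v \in x :: w, adj u v & z \in p u :: c u v].
Proof.
elim: w x => //= y w IH x /andP[xy yw] _.
rewrite -cat_cons mem_cat => /orP[zxy|zw].
  by exists x, y; rewrite !inE !eqxx orbT.
have w0 : w != [::] by case: w zw {IH yw}.
have [|u [v [uw vw uv zuv]]] := IH y yw w0; first by rewrite inE zw orbT.
by exists u, v; split; rewrite // inE ?uw ?vw orbT.
Qed.
End Discretisation.

(* A subdivision of the graph [E] on [0, ..., n-1], except that paths leaving a
   common branch vertex may meet. *)
Definition linkage n (E : rel nat) (G : sgraph) : Prop :=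
  exists (b : nat -> G) (w : nat -> nat -> seq G),
  [/\ forall i j, i < j < n -> b i != b j,
      forall i j, E i j -> path adj (b i) (w i j) /\ last (b i) (w i j) = b j &
      forall i j k l, E i j -> E k l -> uniq [:: i; j; k; l] ->
        ~~ has (mem (b k :: w k l)) (b i :: w i j)].

(** The chains along each path are concatenated and draw the corresponding edge of [E].
    Vertex-disjoint paths consist of edges without common ends, whose chains are apart, and this is
    all that [chain_drawing] asks. *)
Lemma planar_linkage (R : realType) n (E : rel nat) (G : sgraph) :
  (forall i j, E i j -> i < j < n) -> planar R G -> linkage n E G ->
  exists C U, parity_system n E C U.
Proof.
move=> En /planar_chains[p [d [c [pI d0 cP cA]]]] [b [w [bI wP wA]]].
exists (fun k i j => crossings (p (b k)) (p (b i)) (concat_chains c (b i) (w i j))).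
exists (fun i j => upper (p (b i) - p (b j))%R).
have w0 i j : E i j -> w i j != [::].
  move=> Eij; have [_] := wP _ _ Eij; case: (w i j) => //= bij.
  by have := bI _ _ (En _ _ Eij); rewrite bij eqxx.
apply: (chain_drawing_parity (d := d)); split.
- by move=> i j ij; rewrite (inj_eq pI) bI.
- move=> i j Eij; have [pw lw] := wP _ _ Eij.
  by rewrite -lw; exact: concat_chains_path.
move=> i j k l Eij Ekl U z z'; have [[pij _] [pkl _]] := (wP _ _ Eij, wP _ _ Ekl).
move=> /(mem_concat_chains pij (w0 _ _ Eij))[u [v [uw vw uv zuv]]].
move=> /(mem_concat_chains pkl (w0 _ _ Ekl))[u' [v' [uw' vw' uv' zuv']]].
apply: (cA _ _ _ _ uv uv' _ _ _ zuv zuv').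
have /hasPn dis := wA _ _ _ _ Eij Ekl U.
have neq x y : x \in b i :: w i j -> y \in b k :: w k l -> x != y.
  by move=> /dis + yw; apply: contraNneq => ->.
have irr (x y : G) : adj x y -> x != y by apply: contraTneq => ->; rewrite adj_irr.
by rewrite /= !inE !negb_or (irr u v) ?(irr u' v') ?neq.
Qed.

Lemma planar_no_K5 (R : realType) (G : sgraph) : planar R G -> ~ linkage 5 K5_edge G.
Proof.
move=> plG; have E5 i j : K5_edge i j -> i < j < 5 by [].
by move=> /(planar_linkage E5 plG)[C [U /K5_parity]].
Qed.

Lemma planar_no_K33 (R : realType) (G : sgraph) : planar R G -> ~ linkage 6 K33_edge G.
Proof.
move=> plG; have E6 i j : K33_edge i j -> i < j < 6.
  by move=> /andP[/andP[i3 j3] ->]; rewrite (leq_trans i3).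
by move=> /(planar_linkage E6 plG)[C [U /K33_parity]].
Qed.

(** * Straight-line drawings on a parabola *)

Section StraightLine.
Local Open Scope ring_scope.

Definition segment (R : realType) (a b : R * R) (t : R) : R * R :=
  ((1 - t) * a.1 + t * b.1, (1 - t) * a.2 + t * b.2).

Lemma segmentC (R : realType) (a b : R * R) t : segment a b t = segment b a (1 - t).
Proof. by rewrite /segment; congr pair; ring. Qed.

Lemma segment_continuous (R : realType) (a b : R * R) : continuous (segment a b).
Proof.
have aff (c c' : R) : continuous (fun t : R => (1 - t) * c + t * c').
  move=> t; have tc' : {for t, continuous (fun t : R => t * c')} by exact: mulrr_continuous.
  have tc : {for t, continuous (fun t : R => (1 - t) * c)}.
    apply: (@continuous_comp _ _ _ (fun t : R => 1 - t) (fun u => u * c)).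
      by apply: (@continuousB R R^o R^o (cst 1) id); [exact: cvg_cst|exact: cvg_id].
    exact: mulrr_continuous.
  exact: (@continuousD R R^o R^o _ _ t tc tc').
by move=> t; exact: (cvg_pair (aff _ _ t) (aff _ _ t)).
Qed.

Lemma segment_inj (R : realType) (a b : R * R) : a != b -> injective (segment a b).
Proof.
case: a b => a1 a2 [b1 b2] ab s t [e1 e2].
have {}e1 : (s - t) * (b1 - a1) = 0 by rewrite -(subrr ((1 - t) * a1 + t * b1)) -{1}e1; ring.
have {}e2 : (s - t) * (b2 - a2) = 0 by rewrite -(subrr ((1 - t) * a2 + t * b2)) -{1}e2; ring.
move/eqP: e1; rewrite mulf_eq0 !subr_eq0 => /orP[/eqP //|/eqP b1E].
move/eqP: e2; rewrite mulf_eq0 !subr_eq0 => /orP[/eqP //|/eqP b2E].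
by rewrite b1E b2E eqxx in ab.
Qed.

Lemma straight_line_planar (R : realType) (G : sgraph) (p : G -> R * R) :
  injective p ->
  (forall x y z t, adj x y -> 0 < t < 1 -> segment (p x) (p y) t <> p z) ->
  (forall x y u v s t, adj x y -> adj u v -> [set x; y]%SET != [set u; v]%SET ->
    0 < s < 1 -> 0 <= t <= 1 -> segment (p x) (p y) s <> segment (p u) (p v) t) ->
  planar R G.
Proof.
move=> pI pv cr; exists p.
(* [pick] fixes an order of the two ends of an edge; sets that are not edges get a constant arc. *)
pose arc (E : {set G}) : R -> R * R :=
  if [pick z : G * G | adj z.1 z.2 && (E == [set z.1; z.2]%SET)] is Some z
  then segment (p z.1) (p z.2) else fun=> 0.
exists arc.
have arcE E : E \in edges G -> exists x y, [/\ adj x y, E = [set x; y]%SET & arc E = segment (p x) (p y)].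
  rewrite inE => /existsP[x /existsP[y xy]]; rewrite /arc.
  case: pickP => [[u v] /= /andP[uv /eqP->]|/(_ (x, y))]; last by rewrite xy.
  by exists u, v.
split=> //.
- move=> E /arcE[x [y [xy -> ->]]]; split.
  + by apply: continuous_subspaceT; exact: segment_continuous.
  + move=> s t _ _; apply: segment_inj.
    by rewrite (inj_eq pI); apply: contraTneq xy => ->; rewrite adj_irr.
  have -> : segment (p x) (p y) 0 = p x.
    by case: (p x) => *; rewrite /segment subr0 !mul1r !mul0r !addr0.
  have -> : segment (p x) (p y) 1 = p y.
    by case: (p y) => *; rewrite /segment subrr !mul1r !mul0r !add0r.
  apply/seteqP; split=> [a [->|->]|a [z]].
  + by exists x => //=; rewrite set21.
  + by exists y => //=; rewrite set22.
  by rewrite /= in_set2 => /orP[/eqP->|/eqP->] <-; [left|right].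
- move=> E /arcE[x [y [xy _ ->]]] t z; rewrite in_itv /=; exact: pv.
move=> E F /arcE[x [y [xy -> ->]]] /arcE[u [v [uv -> ->]]] EF s t.
by rewrite !in_itv /=; exact: cr.
Qed.

Section Parabola.
Variable R : realType.
Implicit Types (M x y u v s t z : R) (P : R * R).

Definition para z : R * R := (z, z ^+ 2).
Definition low M : R * R := (0, - M).
(** The height 1/2 is above every chord between consecutive integers and below every chord from -1
    to a number at least 1. *)
Definition high : R * R := (0, 2^-1).

(** Positive above the parabola, zero on it and negative below it. *)
Definition elev P : R := P.2 - P.1 ^+ 2.
(** An affine form that vanishes on the line through [para u] and [para v], hence tells the sides of
    this chord apart. *)
Definition chordf u v P : R := P.2 - (u + v) * P.1 + u * v.

Lemma elev_para z : elev (para z) = 0. Proof. by rewrite /elev subrr. Qed.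
Lemma elev_chord x y t : elev (segment (para x) (para y) t) = t * (1 - t) * (x - y) ^+ 2.
Proof. by rewrite /elev /=; ring. Qed.
Lemma elev_low M z t : elev (segment (low M) (para z) t) = (1 - t) * (t * z ^+ 2 - M).
Proof. by rewrite /elev /=; ring. Qed.
Lemma elev_high z t : elev (segment high (para z) t) = (1 - t) * (t * z ^+ 2 + 2^-1).
Proof. by rewrite /elev /=; ring. Qed.
Lemma chordf_para u v z : chordf u v (para z) = (z - u) * (z - v).
Proof. by rewrite /chordf /=; ring. Qed.
Lemma chordf_high u v : chordf u v high = 2^-1 + u * v.
Proof. by rewrite /chordf /=; ring. Qed.
Lemma chordf_segment u v a b t :
  chordf u v (segment a b t) = (1 - t) * chordf u v a + t * chordf u v b.
Proof. by rewrite /chordf /=; ring. Qed.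
Lemma chordf_chord u v t : chordf u v (segment (para u) (para v) t) = 0.
Proof. by rewrite chordf_segment !chordf_para; ring. Qed.

Lemma elev_chord_ge0 x y t : 0 <= t <= 1 -> 0 <= elev (segment (para x) (para y) t).
Proof. by move=> ?; rewrite elev_chord mulr_ge0 ?sqr_ge0 // mulr_ge0; lra. Qed.
Lemma elev_chord_gt0 x y t : x < y -> 0 < t < 1 -> 0 < elev (segment (para x) (para y) t).
Proof.
move=> xy ?; rewrite elev_chord mulr_gt0 //; first by rewrite mulr_gt0; lra.
by rewrite exprn_even_gt0 //= subr_eq0 lt_eqF.
Qed.
Lemma elev_low_le0 M z t : z ^+ 2 < M -> 0 <= t <= 1 -> elev (segment (low M) (para z) t) <= 0.
Proof.
move=> zM t01; rewrite elev_low.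
have tz : t * z ^+ 2 <= z ^+ 2 by rewrite ler_piMl ?sqr_ge0; lra.
by rewrite mulr_ge0_le0; lra.
Qed.
Lemma elev_low_lt0 M z t : z ^+ 2 < M -> 0 <= t < 1 -> elev (segment (low M) (para z) t) < 0.
Proof.
move=> zM t01; rewrite elev_low.
have tz : t * z ^+ 2 <= z ^+ 2 by rewrite ler_piMl ?sqr_ge0; lra.
by rewrite pmulr_rlt0; lra.
Qed.
Lemma elev_high_ge0 z t : 0 <= t <= 1 -> 0 <= elev (segment high (para z) t).
Proof.
move=> t01; rewrite elev_high.
have tz : 0 <= t * z ^+ 2 by rewrite mulr_ge0 ?sqr_ge0 //; lra.
by rewrite mulr_ge0; lra.
Qed.
Lemma elev_high_gt0 z t : 0 <= t < 1 -> 0 < elev (segment high (para z) t).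
Proof.
move=> t01; rewrite elev_high.
have tz : 0 <= t * z ^+ 2 by rewrite mulr_ge0 ?sqr_ge0 //; lra.
by rewrite mulr_gt0; lra.
Qed.

(** [chordf u v] vanishes on the second chord. As the intervals do not interlace, its values at the
    ends of the first chord have the same weak sign and are not both zero, so it is nonzero strictly
    between them. *)
Lemma chords_disjoint x y u v s t : x < y -> u < v -> (x, y) != (u, v) ->
  ~~ [&& x < u, u < y & y < v] -> ~~ [&& u < x, x < v & v < y] ->
  0 < s < 1 -> segment (para x) (para y) s <> segment (para u) (para v) t.
Proof.
move=> xy uv xyuv c1 c2 s01 /(congr1 (chordf u v)).
rewrite chordf_chord chordf_segment !chordf_para.
have [xu|ux|xu] := ltgtP x u.
- have X : 0 < (x - u) * (x - v) by rewrite nmulr_rgt0; lra.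
  have Y : 0 <= (y - u) * (y - v).
    have [yu|uy] := lerP y u; first by rewrite mulr_le0; lra.
    have [yv|vy] := ltrP y v; first by rewrite xu uy yv in c1.
    by rewrite mulr_ge0; lra.
  by nra.
- have [xv|vx] := ltrP x v.
    have X : (x - u) * (x - v) < 0 by rewrite pmulr_rlt0; lra.
    have Y : (y - u) * (y - v) <= 0.
      have [vy|yv] := ltrP v y; first by rewrite ux xv vy in c2.
      by rewrite mulr_ge0_le0; lra.
    by nra.
  have X : 0 <= (x - u) * (x - v) by rewrite mulr_ge0; lra.
  have Y : 0 < (y - u) * (y - v) by rewrite mulr_gt0; lra.
  by nra.
have yv : y != v by apply: contraNneq xyuv => <-; rewrite xu.
rewrite xu subrr mul0r mulr0 add0r => /eqP.
rewrite !mulf_eq0 !subr_eq0 (negPf yv) orbF => /orP[/eqP|/eqP]; lra.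
Qed.

(** The point [high] lies strictly, and the point z weakly, on one side of the chord. The value t =
    1 is excluded because z may be an end of the chord. *)
Lemma chord_high_disjoint u v z s t : u < v -> 0 <= s <= 1 -> 0 <= t < 1 ->
  (0 < 2^-1 + u * v /\ 0 <= (z - u) * (z - v)) \/
  (2^-1 + u * v < 0 /\ (z - u) * (z - v) <= 0) ->
  segment (para u) (para v) s <> segment high (para z) t.
Proof.
move=> uv s01 t01 H /(congr1 (chordf u v)).
rewrite chordf_chord chordf_segment chordf_para chordf_high.
by case: H => -[]; nra.
Qed.

Lemma low_disjoint M y z s t : y != z -> y ^+ 2 < M -> z ^+ 2 < M -> 0 < s -> 0 <= t ->
  segment (low M) (para y) s <> segment (low M) (para z) t.
Proof.
move=> yz yM zM s0 t0 [e1 e2].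
have {}e1 : s * y = t * z by lra.
have {}e2 : s * (y ^+ 2 + M) = t * (z ^+ 2 + M) by lra.
have tpos : 0 < t.
  rewrite lt0r t0 andbT; apply: contra_eq_neq e2 => ->.
  by rewrite mul0r gt_eqF // mulr_gt0 //; have := sqr_ge0 y; lra.
(* The determinant of the two directions is (y - z)(M - yz), and yz < M because both squares are
   less than M. *)
have : t * ((y - z) * (M - y * z)) = 0.
  have -> : t * ((y - z) * (M - y * z)) =
    (y * (t * (z ^+ 2 + M)) - (y ^+ 2 + M) * (t * z)) by ring.
  by rewrite -e1 -e2; ring.
move/eqP; rewrite !mulf_eq0 (gt_eqF tpos) subr_eq0 (negPf yz) /= subr_eq0 => /eqP MM.
by have := sqr_ge0 (y - z); rewrite sqrrB -MM mulr2n; lra.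
Qed.

Lemma high_disjoint y z s t : y != z -> 0 < s -> 0 <= t ->
  segment high (para y) s <> segment high (para z) t.
Proof.
move=> yz s0 t0 [e1 e2].
have {}e1 : s * y = t * z by lra.
have {}e2 : s * (y ^+ 2 - 2^-1) = t * (z ^+ 2 - 2^-1) by lra.
have [tE|tpos] := eqVneq t 0.
  rewrite tE !mul0r in e1 e2; move/eqP: e1; rewrite mulf_eq0 gt_eqF //= => /eqP y0.
  by move: e2; rewrite y0 expr0n /=; lra.
(* Up to sign the second factor is the determinant of the two directions. It vanishes only for yz =
   -1/2, when the segments leave [high] in opposite directions. *)
have : t * ((y - z) * (y * z + 2^-1)) = 0.
  have -> : t * ((y - z) * (y * z + 2^-1)) =
    ((y ^+ 2 - 2^-1) * (t * z) - y * (t * (z ^+ 2 - 2^-1))) by ring.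
  by rewrite -e1 -e2; ring.
move/eqP; rewrite !mulf_eq0 (negPf tpos) subr_eq0 (negPf yz) /= addr_eq0 => /eqP yzE.
have : s * y ^+ 2 = t * (y * z) by rewrite expr2 mulrA e1; ring.
by rewrite yzE; have := sqr_ge0 y; nra.
Qed.

Lemma axis_segment M t : segment (low M) high t = (0, t / 2 - (1 - t) * M).
Proof. by rewrite /segment /=; congr pair; ring. Qed.

End Parabola.
Arguments high {R}.

(* A vertex x is placed on the parabola if k x = None, at [low M] if
   k x = Some true, and at [high] if k x = Some false. *)
Section Placement.
Variable R : realType.
Variables (G : sgraph) (k : G -> option bool) (z : G -> R) (M : R).
Implicit Types (x y u v w b : G) (s t : R).
Hypothesis kI : forall x y, k x = k y -> k x <> None -> x = y.
Hypothesis zI : forall x y, k x = None -> k y = None -> z x = z y -> x = y.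
Hypothesis M0 : 0 < M.
Hypothesis zM : forall x, k x = None -> z x ^+ 2 < M.
(** An edge from [low M] to [high] runs along the second axis, so the parabola is then occupied only
    to the right of it. *)
Hypothesis axisP : forall x y w, adj x y -> k x = Some true -> k y = Some false ->
  k w = None -> 0 < z w.
Hypothesis chordP : forall x y u v, adj x y -> adj u v -> k x = None ->
  k y = None -> k u = None -> k v = None -> ~~ [&& z x < z u, z u < z y & z y < z v].
(** No chord separates [high] from a vertex on the parabola, and none passes through [high]. *)
Hypothesis highP : forall b x y w, k b = Some false -> adj x y -> k x = None ->
  k y = None -> k w = None -> z x < z y ->
  (0 < 2^-1 + z x * z y /\ 0 <= (z w - z x) * (z w - z y)) \/
  (2^-1 + z x * z y < 0 /\ (z w - z x) * (z w - z y) <= 0).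

Definition place x : R * R :=
  match k x with
  | None => para (z x)
  | Some true => low M
  | Some false => high
  end.

(** One direction per edge: [low M] first, then [high], then the parabola from left to right. This
    halves the cases for each edge. *)
Definition oriented x y : bool :=
  match k x, k y with
  | None, None => z x < z y
  | Some _, None | Some true, Some false => true
  | _, _ => false
  end.

Lemma oriented_or x y : adj x y -> oriented x y \/ oriented y x.
Proof.
move=> xy; have nxy : x <> y by move=> xy'; rewrite xy' adj_irr in xy.
rewrite /oriented; case kx : (k x) => [[]|]; case ky : (k y) => [[]|]; auto.
- by case: nxy; apply: kI; rewrite kx.
- by case: nxy; apply: kI; rewrite kx.
by case: (ltgtP (z x) (z y)) => [||/(zI kx ky)]; auto.
Qed.

Lemma elev_low_pt : elev (low M) < 0.
Proof. by rewrite /elev expr0n subr0 oppr_lt0. Qed.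
Lemma elev_high_pt : 0 < elev (high : R * R).
Proof. by rewrite /elev expr0n subr0 invr_gt0. Qed.

Lemma place_inj : injective place.
Proof.
have eh := elev_high_pt; have el := elev_low_pt.
move=> x y; rewrite /place.
case kx : (k x) => [[]|]; case ky : (k y) => [[]|] => E.
all: try by apply: kI; rewrite kx.
all: try by exfalso; move/(congr1 (@elev R)): E; rewrite ?elev_para; lra.
by case: E => /(zI kx ky).
Qed.

Lemma ltW01 (t : R) : 0 < t < 1 -> 0 <= t <= 1. Proof. lra. Qed.

(** Edges from [low M] to the parabola stay below it, chords and edges from [high] to it stay above
    it, and inner points do so strictly. Edges on the same side, and the edge on the axis, are
    compared directly. *)
Lemma oriented_disjoint x y u v s t : adj x y -> adj u v -> oriented x y ->
  oriented u v -> (x, y) != (u, v) -> 0 < s < 1 -> 0 <= t <= 1 ->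
  segment (place x) (place y) s <> segment (place u) (place v) t.
Proof.
move=> xy uv oxy ouv neq s01 t01; move: oxy ouv; rewrite /oriented /place.
have lt_neq (P Q : R * R) : elev P < elev Q -> P <> Q by move=> + PQ; rewrite PQ ltxx.
have gt_neq (P Q : R * R) : elev Q < elev P -> P <> Q by move=> + PQ; rewrite PQ ltxx.
have z_neq a b : k a = None -> k b = None -> a != b -> z a != z b.
  by move=> ka kb; apply: contra_neq => /(zI ka kb).
have y_neq a : k x = Some a -> k u = Some a -> y != v.
  by move=> ka ku; apply: contraNneq neq => ->; rewrite (@kI u x) // ku.
have [s0 s1] : 0 < s /\ 0 <= s < 1 by split; lra.
have sM : 0 < s * M by rewrite mulr_gt0.
have s1M : 0 < (1 - s) * M by rewrite mulr_gt0 //; lra.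
case kx : (k x) => [[]|]; case ky : (k y) => [[]|] //;
  case ku : (k u) => [[]|]; case kv : (k v) => [[]|] //.
- by case/eqP: (y_neq _ kx ku); apply: kI; rewrite ky.
- rewrite axis_segment => _ _ [] e1 e2; have zv := axisP xy kx ky kv.
  have /eqP : t * z v = 0 by lra.
  by rewrite mulf_eq0 (gt_eqF zv) orbF => /eqP t0; move: e2; rewrite t0; lra.
- rewrite axis_segment => _ _ [] e1 e2; have zv := axisP xy kx ky kv.
  have /eqP : t * z v = 0 by lra.
  by rewrite mulf_eq0 (gt_eqF zv) orbF => /eqP t0; move: e2; rewrite t0; lra.
- rewrite axis_segment => _ _ [] e1 _.
  by have := axisP xy kx ky kv; have := axisP xy kx ky ku; nra.
- rewrite axis_segment => _ _ [] e1 _.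
  by have := axisP uv ku kv ky; nra.
- by move=> _ _; apply: low_disjoint; rewrite ?zM ?z_neq ?(y_neq _ kx ku) //; lra.
- move=> _ _; apply: lt_neq; apply: lt_le_trans (elev_low_lt0 (zM ky) s1) _.
  exact: elev_high_ge0.
- move=> _ _; apply: lt_neq; apply: lt_le_trans (elev_low_lt0 (zM ky) s1) _.
  exact: elev_chord_ge0.
- rewrite axis_segment => _ _ [] e1 _.
  by have := axisP uv ku kv ky; nra.
- move=> _ _; apply: gt_neq; apply: le_lt_trans (elev_high_gt0 _ s1).
  exact: elev_low_le0 (zM kv) t01.
- by move=> _ _; apply: high_disjoint; rewrite ?z_neq ?(y_neq _ kx ku) //; lra.
- move=> _ zuv; apply/nesym; apply: chord_high_disjoint => //.
  exact: (highP kx uv ku kv ky).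
- rewrite axis_segment => _ _ [] e1 _.
  by have := axisP uv ku kv kx; have := axisP uv ku kv ky; nra.
- move=> zxy _; apply: gt_neq; apply: le_lt_trans (elev_chord_gt0 zxy s01).
  exact: elev_low_le0 (zM kv) t01.
- move=> zxy _; have [t1|t1] := ltP t 1.
    apply: chord_high_disjoint => //; last exact: (highP ku xy kx ky kv).
      by rewrite ltW01.
    by case/andP: t01 => ->.
  (* Here the second segment has reached the parabola, while an inner point of a chord is strictly
     above it. *)
  have {t1}t1 : t = 1 by lra.
  by apply: gt_neq; rewrite t1 elev_high subrr mul0r; exact: elev_chord_gt0.
move=> zxy zuv; apply: chords_disjoint => //; rewrite ?chordP //.
apply: contraNneq neq => -[/(zI kx ku) -> /(zI ky kv) ->].
by [].
Qed.

Lemma oriented_avoids x y w t : adj x y -> oriented x y -> 0 < t < 1 ->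
  segment (place x) (place y) t <> place w.
Proof.
move=> xy + t01; rewrite /oriented /place.
have lt_neq (P Q : R * R) : elev P < elev Q -> P <> Q by move=> + PQ; rewrite PQ ltxx.
have gt_neq (P Q : R * R) : elev Q < elev P -> P <> Q by move=> + PQ; rewrite PQ ltxx.
have [t0 t1] : 0 < t /\ 0 <= t < 1 by split; lra.
have tM : 0 < t * M by rewrite mulr_gt0.
have t1M : 0 < (1 - t) * M by rewrite mulr_gt0 //; lra.
have eh := elev_high_pt; have el := elev_low_pt.
case kx : (k x) => [[]|]; case ky : (k y) => [[]|] //;
  case kw : (k w) => [[]|].
- by rewrite axis_segment => _ [] ?; lra.
- by rewrite axis_segment => _ [] ?; lra.
- by rewrite axis_segment => _ [] ?; have := axisP xy kx ky kw; lra.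
- move=> _ [] _ e2; have : 0 <= t * z y ^+ 2 by rewrite mulr_ge0 ?sqr_ge0 // ltW.
  by lra.
- by move=> _; apply: lt_neq; apply: lt_trans (elev_low_lt0 (zM ky) t1) _.
- by move=> _; apply: lt_neq; rewrite elev_para elev_low_lt0 ?zM.
- by move=> _; apply: gt_neq; apply: lt_trans (elev_high_gt0 _ t1).
- move=> _ [] e1 e2; have /eqP : t * z y = 0 by lra.
  rewrite mulf_eq0 (gt_eqF t0) => /eqP zy0.
  by move: e2; rewrite zy0 expr0n /=; lra.
- by move=> _; apply: gt_neq; rewrite elev_para elev_high_gt0.
- by move=> zxy; apply: gt_neq; apply: lt_trans (elev_chord_gt0 zxy t01).
- move=> zxy /(congr1 (chordf (z x) (z y))); rewrite chordf_chord chordf_high.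
  by case: (highP kw xy kx ky kx zxy) => -[]; lra.
by move=> zxy; apply: gt_neq; rewrite elev_para elev_chord_gt0.
Qed.

Lemma planar_placement : planar R G.
Proof.
apply: (straight_line_planar place_inj).
  move=> x y w t xy t01; have [xy_or|yx_or] := oriented_or xy.
    exact: oriented_avoids.
  rewrite segmentC; apply: oriented_avoids => //; first by rewrite adj_sym.
  by lra.
move=> x y u v s t xy uv E s01 t01.
wlog oxy : x y xy s s01 E / oriented x y.
  move=> H; have [|yx_or] := oriented_or xy; first exact: H.
  rewrite segmentC; apply: H => //; rewrite 1?adj_sym //; first by lra.
  by rewrite finset.setUC.
wlog ouv : u v uv t t01 E / oriented u v.
  move=> H; have [|yx_or] := oriented_or uv; first exact: H.
  rewrite (segmentC (place u)); apply: H => //; rewrite 1?adj_sym //; first by lra.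
  by rewrite [X in _ != X]finset.setUC.
apply: oriented_disjoint => //.
by apply: contraNneq E => -[-> ->].
Qed.
End Placement.
End StraightLine.

(** * Drawings of double fans, bipyramids and cones *)

Section Drawings.
Variables (R : realType) (G : sgraph).

Lemma square_bound (z : G -> R) : exists2 M : R, (0 < M)%R & forall x, (z x ^+ 2 < M)%R.
Proof.
exists (1 + \sum_x z x ^+ 2)%R.
  by rewrite ltr_pwDl ?sumr_ge0 // => x _; exact: sqr_ge0.
move=> x; rewrite (bigD1 x) //= addrCA ltrDl ltr_pwDl // sumr_ge0 // => y _.
exact: sqr_ge0.
Qed.

(** The path occupies positive integers. No vertex lies between the ends of a chord, [high] is above
    all chords, and the axis is free for an edge between the two apexes. *)
Lemma planar_double_fan (h : G -> bool + nat) : injective h ->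
  (forall x y m n, adj x y -> h x = inr m -> h y = inr n -> m = n.+1 \/ n = m.+1) ->
  planar R G.
Proof.
move=> hI hadj.
pose k x := if h x is inl b then Some b else None.
pose i x := if h x is inr m then m else 0.
have hE x : k x = None -> h x = inr (i x) by rewrite /k /i; case: (h x).
pose z x : R := ((i x).+1)%:R%R.
have [M M0 zM] := square_bound z.
have consec x y : adj x y -> k x = None -> k y = None -> i x = (i y).+1 \/ i y = (i x).+1.
  by move=> xy /hE kx /hE ky; exact: hadj kx ky.
apply: (@planar_placement R G k z M) => //.
- move=> x y; rewrite /k => kxy kx; apply: hI; move: kxy kx.
  by case: (h x) => // b; case: (h y) => // b' [->].
- move=> x y /hE kx /hE ky /eqP; rewrite eqr_nat eqSS => /eqP ixy.
  by apply: hI; rewrite kx ky ixy.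
- move=> x y u v xy _ kx ky _ _; rewrite !ltr_nat.
  by have := consec _ _ xy kx ky; lia.
move=> b x y w _ xy kx ky _; rewrite ltr_nat => ixy; left.
have -> : z y = (z x + 1)%R.
  by rewrite /z natr1; congr (_%:R)%R; have := consec _ _ xy kx ky; lia.
have z0 a : (0 < z a)%R by rewrite /z ltr0n.
split; first by have := z0 x; nra.
have [wx|xw] := leqP (i w) (i x).
  have : (z w <= z x)%R by rewrite ler_nat.
  by move=> ?; rewrite mulr_le0; lra.
have : (z x + 1 <= z w)%R by rewrite natr1 ler_nat.
by move=> ?; rewrite mulr_ge0; lra.
Qed.

(** The cycle occupies the abscissas -1, 0, ..., r - 2. Chords between consecutive integers pass
    below [high], and the closing chord passes above it since r - 2 >= 1. The axis is blocked, which
    is why the apexes must not be adjacent. *)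
Lemma planar_bipyramid r (h : G -> bool + 'I_r) : 3 <= r -> injective h ->
  (forall x y i j, adj x y -> h x = inr i -> h y = inr j -> cycle_adj i j) ->
  (forall x y, adj x y -> h x = inl true -> h y = inl false -> False) ->
  planar R G.
Proof.
move=> r3 hI hadj hab.
pose k x := if h x is inl b then Some b else None.
pose i x := if h x is inr m then nat_of_ord m else 0.
pose z x : R := ((i x)%:R - 1)%R.
have [M M0 zM] := square_bound z.
have hE x : k x = None -> exists2 m : 'I_r, h x = inr m & i x = m.
  by rewrite /k /i; case: (h x) => // m _; exists m.
have hE' x b : k x = Some b -> h x = inl b by rewrite /k; case: (h x) => // ? [->].
have ir x : k x = None -> i x < r by move=> /hE[m _ ->].
have ord_succ (m : 'I_r) : nat_of_ord (ordS m) = if m.+1 == r then 0 else m.+1.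
  rewrite /=; case: eqP => [->|mr]; first by rewrite modnn.
  by rewrite modn_small // ltn_neqAle; apply/andP; split; [apply/eqP|].
have chord x y : adj x y -> k x = None -> k y = None -> i x < i y ->
    i y = (i x).+1 \/ (i x = 0 /\ i y = r.-1).
  move=> xy /hE[m hx ->] /hE[n hy ->] mn.
  have := hadj _ _ _ _ xy hx hy; rewrite /cycle_adj => /andP[_] /orP[/eqP e|/eqP e].
    by left; move: mn; rewrite -e ord_succ; case: eqP.
  by move: mn; rewrite -e ord_succ; case: eqP => nr; lia.
have zlt a b : (z a < z b)%R = (i a < i b) by rewrite ltrD2r ltr_nat.
apply: (@planar_placement R G k z M) => //.
- move=> x y; rewrite /k => kxy kx; apply: hI; move: kxy kx.
  by case: (h x) => // b; case: (h y) => // b' [->].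
- move=> x y /hE[m hx mE] /hE[n hy nE] /addIr/eqP; rewrite eqr_nat mE nE => /eqP mn.
  by apply: hI; rewrite hx hy (ord_inj mn).
- by move=> x y w xy /hE' kx /hE' ky; case: (hab _ _ xy kx ky).
- move=> x y u v xy uv kx ky ku kv; rewrite !zlt.
  have := ir _ kv; have := chord _ _ xy kx ky; have := chord _ _ uv ku kv; lia.
move=> b x y w _ xy kx ky kw; rewrite zlt => ixy.
have [yx|[x0 yr]] := chord _ _ xy kx ky ixy.
  left; have -> : z y = (z x + 1)%R by rewrite /z yx -natr1; ring.
  split.
    rewrite /z subrK; have [->|ix0] := posnP (i x); first by rewrite mulr0; lra.
    have : (1 <= (i x)%:R :> R)%R by rewrite ler1n.
    by move=> ?; rewrite ltr_wpDr // mulr_ge0; lra.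
  have [wx|xw] := leqP (i w) (i x).
    have : (z w <= z x)%R by rewrite lerD2r ler_nat.
    by move=> ?; rewrite mulr_le0; lra.
  have : (z x + 1 <= z w)%R by rewrite /z subrK lerBrDr natr1 ler_nat.
  by move=> ?; rewrite mulr_ge0; lra.
right; have -> : (z x = - 1)%R by rewrite /z x0 sub0r.
have zy : (1 <= z y)%R.
  by rewrite /z lerBrDr (_ : 1 + 1 = 2%:R)%R // ler_nat yr; lia.
split; first by lra.
have : (z w <= z y)%R by rewrite lerD2r ler_nat; have := ir _ kw; lia.
have : (- 1 <= z w)%R by rewrite /z lerBrDr addNr ler0n.
by move=> ? ?; rewrite mulr_ge0_le0 //; lra.
Qed.

(** The apex is [low M] and no vertex is placed at [high], so the chords only have to avoid crossing
    each other. *)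
Lemma planar_cone (h : G -> option nat) : injective h ->
  (forall x y u v a b c d, adj x y -> adj u v -> h x = Some a -> h y = Some b ->
    h u = Some c -> h v = Some d -> ~~ [&& a < c, c < b & b < d]) ->
  planar R G.
Proof.
move=> hI hcross.
pose k x := if h x is None then Some true else None.
pose i x := if h x is Some m then m else 0.
pose z x : R := ((i x)%:R)%R.
have [M M0 zM] := square_bound z.
have hE x : k x = None -> h x = Some (i x) by rewrite /k /i; case: (h x).
have kfalse x : k x <> Some false by rewrite /k; case: (h x).
apply: (@planar_placement R G k z M) => //.
- move=> x y; rewrite /k => kxy kx; apply: hI; move: kxy kx.
  by case: (h x) => //; case: (h y).
- move=> x y /hE hx /hE hy /eqP; rewrite eqr_nat => /eqP mn.
  by apply: hI; rewrite hx hy mn.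
- by move=> x y w _ _ /kfalse.
- move=> x y u v xy uv /hE hx /hE hy /hE hu /hE hv.
  by rewrite !ltr_nat; exact: hcross xy uv hx hy hu hv.
by move=> b x y w /kfalse.
Qed.
End Drawings.

(** * Degrees, isomorphisms and joins *)

Section AlphaIr.
Variable G : sgraph.

(** Singletons are always irregular independent sets, so the value 1 excludes precisely the
    nonadjacent pairs of different degrees. *)
Lemma alpha_ir1P : alpha_ir G = 1 <->
  0 < #|G| /\ (forall x y : G, deg x != deg y -> adj x y).
Proof.
have irr1 (x : G) : irregular_independent [set x].
  apply/andP; split; apply/forall_inP => y /set1P ->; apply/forall_inP => z /set1P ->.
    by rewrite adj_irr.
  by rewrite eqxx.
have le_alpha (A : {set G}) : irregular_independent A -> #|A| <= alpha_ir G.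
  by move=> AA; rewrite /alpha_ir (bigD1 A) //= leq_maxl.
split=> [a1|[/card_gt0P[x _] deg_adj]].
  split.
    rewrite lt0n; apply: contra_eq_neq a1 => G0; rewrite /alpha_ir big1 // => A _.
    by apply/eqP; rewrite -leqn0 -G0 max_card.
  move=> x y dxy; apply: contraTT isT => nxy.
  suff /le_alpha : irregular_independent [set x; y].
    by rewrite a1 cards2 (contraNneq _ dxy) // => ->.
  apply/andP; split; apply/forall_inP => u /set2P[]->; apply/forall_inP => v /set2P[]->;
    rewrite ?eqxx ?adj_irr //; first (by rewrite adj_sym); apply/implyP => _ //.
  by rewrite eq_sym.
apply/eqP; rewrite eqn_leq; apply/andP; split; last first.
  by rewrite -(cards1 x) le_alpha.
apply/bigmax_leqP => A /andP[/forall_inP ind /forall_inP irr].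
rewrite leqNgt; apply/card_gt1P => -[u [v [uA vA uv]]].
have := forall_inP (ind u uA) v vA; have := implyP (forall_inP (irr u uA) v vA) uv.
by move=> /deg_adj ->.
Qed.

Lemma regular_alpha_ir : 0 < #|G| -> regular G -> alpha_ir G = 1.
Proof.
move=> G0 [d dG]; apply/alpha_ir1P; split=> // x y.
by rewrite !dG eqxx.
Qed.
End AlphaIr.

Lemma isomorphic_deg (G H : sgraph) (f : G -> H) : bijective f ->
  (forall x y, adj (f x) (f y) = adj x y) -> forall x, deg (f x) = deg x.
Proof.
move=> fB fadj x; rewrite /deg -(card_imset _ (bij_inj fB)); apply: eq_card => y.
have [g fK gK] := fB; rewrite -(gK y) mem_imset ?inE ?fadj //; exact: bij_inj.
Qed.

Lemma isomorphic_eq_adj (V : finType) (e e' : rel V) se ie se' ie' :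
  e =2 e' -> isomorphic (@SGraph V e se ie) (@SGraph V e' se' ie').
Proof. by move=> ee'; exists id; split; [exists id|move=> x y; rewrite /= ee']. Qed.

Lemma isomorphic_sym (G H : sgraph) : isomorphic G H -> isomorphic H G.
Proof.
move=> [f [[g fK gK] fadj]]; exists g; split; first by exists f.
by move=> x y; rewrite -fadj !gK.
Qed.

Lemma isomorphic_trans (G H K : sgraph) : isomorphic G H -> isomorphic H K -> isomorphic G K.
Proof.
move=> [f [fB fa]] [g [gB ga]]; exists (g \o f); split; first exact: bij_comp.
by move=> x y /=; rewrite ga fa.
Qed.

Lemma card_sum_type (A B : finType) (P : {pred A + B}) :
  #|P| = #|[pred x | inl x \in P]| + #|[pred x | inr x \in P]|.
Proof. by rewrite -!sum1_card big_sumType. Qed.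

Lemma deg_inl (A B : sgraph) (x : A) : deg (inl x : graph_join A B) = deg x + #|B|.
Proof.
by rewrite /deg card_sum_type; congr addn; apply: eq_card => y; rewrite !inE.
Qed.

Lemma deg_inr (A B : sgraph) (x : B) : deg (inr x : graph_join A B) = #|A| + deg x.
Proof.
by rewrite /deg card_sum_type; congr addn; apply: eq_card => y; rewrite !inE.
Qed.

(** Vertices of different degrees lie on different sides of the join, hence are adjacent. *)
Lemma join_alpha_ir (G A B : sgraph) : 0 < #|G| -> regular A -> regular B ->
  isomorphic G (graph_join A B) -> alpha_ir G = 1.
Proof.
move=> G0 [a aA] [b bB] [f [fB fadj]]; apply/alpha_ir1P; split=> // x y.
rewrite -!(isomorphic_deg fB fadj) -fadj.
by case: (f x) (f y) => u [] v //; rewrite ?deg_inl ?deg_inr ?aA ?bB ?eqxx.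
Qed.

Lemma regular_complete r : regular (complete r).
Proof.
exists r.-1 => x; rewrite -[r in RHS]card_ord (cardD1 x) inE.
by apply: eq_card => y; rewrite !inE andbT eq_sym.
Qed.

Lemma deg_edgeless r x : deg (x : edgeless r) = 0.
Proof. by apply: eq_card0 => y; rewrite !inE. Qed.

Lemma regular_edgeless r : regular (edgeless r).
Proof. by exists 0; exact: deg_edgeless. Qed.

Lemma deg_disjoint_union (I : finType) (F : I -> sgraph) (i : I) (x : F i) :
  deg (existT (fun i => vertex (F i)) i x : disjoint_union F) = deg x.
Proof.
pose inj (y : F i) : disjoint_union F := existT (fun i => vertex (F i)) i y.
have injI : injective inj by move=> y z /eqP; rewrite -tag_eqE /tag_eq eqxx tagged_asE => /eqP.
rewrite /deg -[RHS](card_imset _ injI); apply: eq_card => -[j y].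
rewrite !inE /= /dunion_adj /=; case: eqP => [ij|ij] /=.
  case: _ / ij y => y; rewrite tagged_asE.
  by rewrite -[X in X \in _]/(inj y) mem_imset // inE.
by apply/esym/imsetP => -[z _ [/esym]].
Qed.

Lemma regular_disjoint_union (I : finType) (F : I -> sgraph) d :
  (forall i (x : F i), deg x = d) -> regular (disjoint_union F).
Proof. by move=> Fd; exists d => -[i x]; rewrite deg_disjoint_union. Qed.

Lemma val_ordS r (i : 'I_r) : ordS i = (if i.+1 == r then 0 else i.+1) :> nat.
Proof.
rewrite /=; case: eqP => [->|ir]; first by rewrite modnn.
by rewrite modn_small // ltn_neqAle; apply/andP; split; [apply/eqP|].
Qed.

Lemma deg_cycle r (x : cycle_graph r) : 3 <= r -> deg x = 2.
Proof.
move=> r3; have xr : (x : 'I_r) < r by [].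
have Sx : ordS x != x.
  by apply/eqP => /(congr1 (@nat_of_ord r)); rewrite val_ordS; case: eqP; lia.
have SSx : ordS (ordS x) != x.
  apply/eqP => /(congr1 (@nat_of_ord r)); rewrite !val_ordS.
  by case: (x.+1 =P r); case: eqP; lia.
have -> : deg x = #|[set ordS x; ord_pred x]|.
  apply: eq_card => y; rewrite !inE /= /cycle_adj.
  rewrite (eq_sym y (ord_pred x)) (can2_eq (@ord_predK r) (@ordSK r)) (eq_sym y) (eq_sym x (ordS y)).
  by have [<-|] //= := eqVneq x y; rewrite orbb (negPf Sx).
by rewrite cards2 -(inj_eq (@ordS_inj r)) ord_predK SSx.
Qed.

(** * Planarity of the joins in the list *)

(** Via [g] the graph [B] is a subgraph of a path, the form in which [planar_double_fan] takes
    it. *)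
Definition double_fan_adj (B : sgraph) (g : B -> nat) : Prop :=
  injective g /\ forall x y : B, adj x y -> g x = (g y).+1 \/ g y = (g x).+1.

Lemma planar_join_fan (R : realType) (G A B : sgraph) (a : A -> bool) (g : B -> nat) :
  injective a -> double_fan_adj g -> isomorphic G (graph_join A B) -> planar R G.
Proof.
move=> aI [gI gadj] [f [fB fadj]].
pose h (u : graph_join A B) : bool + nat :=
  match u with inl x => inl (a x) | inr y => inr (g y) end.
apply: (@planar_double_fan R G (h \o f)).
  apply: inj_comp (bij_inj fB) => -[u|u] [v|v] //= [].
    by move=> /aI->.
  by move=> /gI->.
move=> x y m n; rewrite -fadj /=; case: (f x) (f y) => [//|u] [//|v] /= uv [<-] [<-].
exact: gadj.
Qed.

Lemma double_fan_edgeless r : double_fan_adj (fun x : edgeless r => nat_of_ord x).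
Proof. by split=> // x y; exact: ord_inj. Qed.

Lemma double_fan_copies_K2 s : double_fan_adj
  (fun x : copies s (complete 2) => 2 * (tag x : 'I_s) + (tagged x : 'I_2)).
Proof.
split=> [[i j] [i' j']|[i j] [i' j']] /=.
  have := ltn_ord j; have := ltn_ord j' => j'2 j2 e.
  have ii' : i = i' by apply: ord_inj; lia.
  by rewrite ii'; congr existT; apply: ord_inj; subst; lia.
rewrite /dunion_adj /=; case/andP=> /eqP ii'; case: _ / ii' j' => j'.
rewrite tagged_asE /= -val_eqE /=.
by have := ltn_ord j; have := ltn_ord j'; lia.
Qed.

Lemma ord1_bool_inj : injective (fun _ : 'I_1 => true).
Proof. by move=> i j _; rewrite !ord1. Qed.

Lemma ord2_bool_inj : injective (fun i : 'I_2 => i == ord0).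
Proof. by case=> [[|[|]] ?] // [[|[|]] ?] // _; exact: ord_inj. Qed.

Lemma planar_bipyramid_join (R : realType) (G : sgraph) r : 3 <= r ->
  isomorphic G (graph_join (edgeless 2) (cycle_graph r)) -> planar R G.
Proof.
move=> r3 [f [fB fadj]].
pose h (u : graph_join (edgeless 2) (cycle_graph r)) : bool + 'I_r :=
  match u with inl x => inl (x == ord0 :> 'I_2) | inr y => inr y end.
apply: (@planar_bipyramid R G r (h \o f)) => //.
- apply: inj_comp (bij_inj fB) => -[u|u] [v|v] //= [].
    by move=> /ord2_bool_inj->.
  by move=> ->.
- move=> x y i j; rewrite -fadj /=; case: (f x) (f y) => [//|u] [//|v] /= uv [<-] [<-].
  exact: uv.
by move=> x y; rewrite -fadj /=; case: (f x) (f y) => [u|//] [v|//].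
Qed.

Definition block_start m (c : 'I_m -> nat) (i : 'I_m) : nat := \sum_(k < m | k < i) c k.

Lemma block_start_lt m (c : 'I_m -> nat) (i j : 'I_m) : i < j ->
  block_start c i + c i <= block_start c j.
Proof.
move=> ij; rewrite {2}/block_start (bigD1 i) //= addnC leq_add2l.
rewrite /block_start [in leqRHS](bigID (fun k : 'I_m => k < i)) /=.
rewrite -[leqLHS]addn0 leq_add //.
apply: eq_leq; apply: eq_bigl => k; rewrite -val_eqE /=; lia.
Qed.

(** The cycles occupy disjoint intervals of positions. Edges of one cycle join consecutive positions
    or the first and the last one, so no two chords interlace. *)
Lemma planar_cycles_cone (R : realType) (G : sgraph) m (c : 'I_m -> nat) :
  isomorphic G (graph_join (complete 1) (disjoint_union (fun i : 'I_m => cycle_graph (c i)))) ->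
  planar R G.
Proof.
move=> [f [fB fadj]].
pose h (u : graph_join (complete 1) (disjoint_union (fun i : 'I_m => cycle_graph (c i)))) : option nat :=
  match u with inl x => None | inr y => Some (block_start c (tag y) + (tagged y : 'I_(c (tag y)))) end.
have blk (i j : 'I_m) : [\/ i = j, block_start c i + c i <= block_start c j |
    block_start c j + c j <= block_start c i].
  case: (ltngtP i j) => [/block_start_lt|/block_start_lt|/ord_inj]; [by constructor 2|by constructor 3|by constructor 1].
apply: (@planar_cone R G (h \o f)).
  apply: inj_comp (bij_inj fB) => -[u|[i u]] [v|[j v]] //=.
    by rewrite (ord1 u) (ord1 v).
  move=> []; have [ij|ij|ij] := blk i j; have := ltn_ord u; have := ltn_ord v; try lia.
  case: _ / ij v => v _ _ /addnI /ord_inj -> //.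
move=> x y u v a b c' d; rewrite -!fadj /=.
case: (f x) (f y) => [//|[i x1]] [//|[i' x2]] /=.
case: (f u) (f v) => [//|[j u1]] [//|[j' u2]] /=.
rewrite /dunion_adj /= => /andP[/eqP ii']; case: _ / ii' x2 => x2.
rewrite tagged_asE /= => xx /andP[/eqP jj']; case: _ / jj' u2 => u2.
rewrite tagged_asE /= => uu [<-] [<-] [<-] [<-].
have := ltn_ord x1; have := ltn_ord x2; have := ltn_ord u1; have := ltn_ord u2.
have [ij|ij|ij] := blk i j; [|lia|lia].
move: uu; case: _ / ij u1 u2 => u1 u2; rewrite /cycle_adj.
move=> /andP[_ uu] u2c u1c x2c x1c; apply/negP => /and3P[].
rewrite !ltn_add2l => xu ux xu2.
move: xx => /andP[_ xx].
have U : (nat_of_ord (ordS u1) == u2) || (nat_of_ord (ordS u2) == u1) by rewrite uu.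
have X : (nat_of_ord (ordS x1) == x2) || (nat_of_ord (ordS x2) == x1) by rewrite xx.
move: U X; rewrite !val_ordS.
case: (u1.+1 =P c i); case: (u2.+1 =P c i); case: (x1.+1 =P c i); case: (x2.+1 =P c i); lia.
Qed.

(** * Linkages of K5 and K33 in joins *)

Lemma linkage_hom n E (G H : sgraph) (f : G -> H) : injective f ->
  (forall x y, adj x y -> adj (f x) (f y)) -> linkage n E G -> linkage n E H.
Proof.
move=> fI fadj [b [w [bI wP wA]]].
exists (f \o b), (fun i j => map f (w i j)); split.
- by move=> i j ij /=; rewrite (inj_eq fI) bI.
- move=> i j /wP[p l]; split; last by rewrite /= last_map l.
  exact: homo_path p.
move=> i j k l Eij Ekl U.
rewrite -[(f \o b) k :: _]/(map f (b k :: w k l)) -[(f \o b) i :: _]/(map f (b i :: w i j)).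
apply: contra (wA _ _ _ _ Eij Ekl U) => /hasP[_ /mapP[x xw ->] xw'].
by apply/hasP; exists x => //; case/mapP: xw' => y yw /fI->.
Qed.

Lemma linkage_isomorphic n E (G H : sgraph) : isomorphic G H ->
  linkage n E H -> linkage n E G.
Proof.
move=> [f [[g fK gK] fadj]]; apply: (linkage_hom (can_inj gK)) => x y.
by rewrite -fadj !gK.
Qed.

Lemma linkage_K33 (G : sgraph) (A B : {set G}) : 2 < #|A| -> 2 < #|B| ->
  {in A & B, forall x y, adj x y} -> linkage 6 K33_edge G.
Proof.
move=> /card_geqP[s [us ss sA]] /card_geqP[t [ut st tB]] AB.
have x0 : G by case: s ss {us sA} => // x *; exact: x.
have U : uniq (s ++ t).
  rewrite cat_uniq us ut andbT; apply/hasPn => x xt; apply/negP => xs.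
  by have := AB x x (sA x xs) (tB x xt); rewrite adj_irr.
have sz : size (s ++ t) = 6 by rewrite size_cat ss st.
pose b := nth x0 (s ++ t).
have bI i j : i < 6 -> j < 6 -> (b i == b j) = (i == j).
  by move=> i6 j6; rewrite nth_uniq ?sz.
exists b, (fun _ j => [:: b j]); split.
- move=> i j /andP[ij j6]; rewrite bI ?(ltn_trans ij) //; lia.
- move=> i j /andP[/andP[i3 j3] j6] /=; split=> //; rewrite andbT.
  apply: AB.
    by apply/sA; rewrite /b nth_cat ss i3 mem_nth ?ss.
  by apply/tB; rewrite /b nth_cat ss ltnNge j3 /= mem_nth ?st; lia.
move=> i j k l /andP[/andP[i3 j3] j6] /andP[/andP[k3 l3] l6].
rewrite /= !inE !orbF !bI //; lia.
Qed.

Definition walk (G : sgraph) (x : G) w y := path adj x w && (last x w == y).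

(** Disjointness is symmetric in the two paths, so the finite case analyses below run over i < k
    only. *)
Lemma linkage_K5 (G : sgraph) (b : nat -> G) (w : nat -> nat -> seq G) :
  (forall i j, i < j < 5 -> b i != b j) ->
  (forall i j, K5_edge i j -> walk (b i) (w i j) (b j)) ->
  (forall i j k l, K5_edge i j -> K5_edge k l -> uniq [:: i; j; k; l] -> i < k ->
     forall x, x \in b i :: w i j -> x \in b k :: w k l -> False) ->
  linkage 5 K5_edge G.
Proof.
move=> bI wP wA.
have {}wA i j k l : K5_edge i j -> K5_edge k l -> uniq [:: i; j; k; l] -> i < k ->
     ~~ has (mem (b k :: w k l)) (b i :: w i j).
  by move=> *; apply/hasPn => x xs; apply/negP => xt; apply: (wA i j k l _ _ _ _ x).
exists b, w; split=> //; first by move=> i j /wP /andP[? /eqP].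
move=> i j k l Eij Ekl U; have [ik|ki|ik] := ltngtP i k; first exact: wA.
  rewrite has_sym; apply: wA => //.
  by move: U; rewrite /= !inE; lia.
by move: U; rewrite ik /= !inE eqxx !orbT.
Qed.

Section Apex.
Variables (H : sgraph) (v : nat -> H) (m : nat).
Hypothesis vE : forall n, n < m -> adj (v n) (v n.+1).
Hypothesis vI : forall n n', n <= m -> n' <= m -> v n = v n' -> n = n'.

(** The part of the path from [v a] to [v b]; as in [path], the starting vertex is left out. *)
Definition stretch a b := [seq v n | n <- iota a.+1 (b - a)].

Lemma stretch_walk a b : a <= b -> b <= m -> walk (v a) (stretch a b) (v b).
Proof.
rewrite /walk /stretch => /subnKC <-; move: (b - a) => k; rewrite addKn.
elim: k a => [|k IH] a am /=; first by rewrite addn0.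
by rewrite vE ?(leq_trans _ am) ?addnS ?ltnS ?leq_addr //= -addSn IH // addSn -addnS.
Qed.

Lemma walk_rcons (G : sgraph) (x y z : G) w : walk x w y -> adj y z -> walk x (rcons w z) z.
Proof. by rewrite /walk rcons_path last_rcons eqxx andbT => /andP[-> /eqP->]. Qed.

Lemma walk1 (G : sgraph) (x y : G) : adj x y -> walk x [:: y] y.
Proof. by move=> xy; rewrite /walk /= xy eqxx. Qed.

Lemma walk_map (G K : sgraph) (f : G -> K) x w y :
  (forall x y, adj x y -> adj (f x) (f y)) -> walk x w y -> walk (f x) (map f w) (f y).
Proof.
move=> fadj /andP[xw /eqP<-]; rewrite /walk last_map eqxx andbT.
exact: homo_path xw.
Qed.

(* The chord from [v 0] to [v i] and the paths from [v j] and [v l], together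
   with the path [v], form a subdivided K4 with branch vertices
   [v i, v (minn j l), v 0, v i.-1]. *)
Lemma crossing_chords_linkage (A : sgraph) (a : A) i j l :
  1 < i -> i < j <= m -> i < l <= m ->
  adj (v 0) (v i) -> adj (v 0) (v j) -> adj (v i.-1) (v l) ->
  linkage 5 K5_edge (graph_join A H).
Proof.
move=> i1 /andP[ij jm] /andP[il lm] a0i a0j ail.
pose q := minn j l.
have [iq qj ql] : [/\ i < q, q <= j & q <= l] by rewrite /q; split; lia.
have aii : adj (v i.-1) (v i) by have := @vE i.-1; rewrite prednK; [apply; lia|lia].
pose r n : graph_join A H := inr (v n).
have inr_adj (x y : H) : adj x y -> adj (inr x : graph_join A H) (inr y) by [].
(* Branch vertex 0 is the apex, so entry 0 is a dummy; the others are the positions of the branch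
   vertices on the path [v]. *)
pose pos n := nth 0 [:: 0; i; q; 0; i.-1] n.
(* Positions visited after the start. The paths 2-3 and 2-4 follow [v] from q to j and to l, then
   take the chords back to [v 0] and [v i.-1]; as q is the minimum, one of the two stretches is
   empty. *)
pose idx n n' :=
  match n, n' with
  | 1, 2 => iota i.+1 (q - i)
  | 2, 3 => rcons (iota q.+1 (j - q)) 0
  | 2, 4 => rcons (iota q.+1 (l - q)) i.-1
  | 3, 4 => iota 1 (i.-1 - 0)
  | _, _ => [:: pos n']
  end.
pose b n := if n == 0 then inl a : graph_join A H else r (pos n).
have r_stretch x y : map r (iota x.+1 (y - x)) = map inr (stretch x y) by rewrite /stretch -map_comp.
have idx_le n n' : 0 < n < 5 -> n' < 5 -> {in pos n :: idx n n', forall x, x <= m}.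
  case: n => [|[|[|[|[|n]]]]] //= _; case: n' => [|[|[|[|[|n']]]]] //= _ x;
    rewrite /pos /= !inE ?mem_rcons ?inE ?mem_iota; lia.
apply: (@linkage_K5 (graph_join A H) b (fun n n' => map r (idx n n'))).
- move=> n n' /andP[+ n5]; case: n' n5 => [|[|[|[|[|n']]]]] // _; case: n => [|[|[|[|n]]]] // _;
    rewrite /b /r /pos /=; apply/eqP => //; case=> /vI; lia.
- move=> n n' /andP[+ n5]; case: n' n5 => [|[|[|[|[|n']]]]] // _; case: n => [|[|[|[|n]]]] // _.
  all: rewrite /idx ?map_rcons ?r_stretch; try (by apply: walk1); rewrite /b /r /pos /=.
  + by apply: walk_map => //; apply: stretch_walk; lia.
  + by apply: walk1; rewrite /= adj_sym.
  + by apply: walk_rcons; [apply: walk_map => //; apply: stretch_walk; lia|rewrite /= adj_sym].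
  + by apply: walk1; rewrite /= adj_sym.
  + by apply: walk_rcons; [apply: walk_map => //; apply: stretch_walk; lia|rewrite /= adj_sym].
  + by apply: walk_map => //; apply: stretch_walk; lia.
move=> n n' k k' /andP[nn' n5] /andP[kk' k5] U nk.
have k0 : 0 < k < 5 by lia.
have bk : b k :: map r (idx k k') = map r (pos k :: idx k k') by rewrite /b; case: eqP k0 => // ->.
have r_inj x y : x <= m -> y <= m -> r x = r y -> x = y by move=> xm ym []; exact: vI.
move=> z zn zk.
have {zk bk} /mapP[y yk zE] : z \in map r (pos k :: idx k k') by rewrite -bk.
have ym := idx_le _ _ k0 k5 y yk.
(* Since k > 0 the second path avoids the apex, so a common vertex of the two paths lies on [v]. *)
have [x [xn xm zE']] : exists x, [/\ x \in (if n == 0 then [:: pos n'] else pos n :: idx n n'), x <= m & z = r x].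
  move: zn; rewrite /b; case: (eqVneq n 0) => [->|n0]; last first.
    rewrite -[_ :: _]/(map r (pos n :: idx n n')) => /mapP[x xn ->]; exists x; split=> //.
    by apply: idx_le xn => //; lia.
  rewrite !inE => /orP[/eqP za|/eqP ->]; first by rewrite za in zE.
  exists (pos n'); split; rewrite ?mem_head //.
  by apply: (@idx_le n' 0) => //; [lia|exact: mem_head].
have {zE zE' z zn} xy : x = y by apply: r_inj => //; rewrite -zE -zE'.
rewrite -{}xy {y ym} in yk; move: xn yk U.
move: nn' n5 kk' k5 nk; case: n' => [|[|[|[|[|n']]]]] // + _; case: n => [|[|[|[|n]]]] // _;
  case: k' => [|[|[|[|[|k']]]]] // + _; case: k {k0} => [|[|[|[|k]]]] // _ _;
  rewrite /idx /pos /= !inE ?mem_rcons ?inE ?mem_iota; lia.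
Qed.

(** A subdivided K5 with branch vertices [a], [a'], [v 1], [v m], [v 0]: the cycle closed by the
    edge from [v 0] to [v m] connects the last three, and [w] connects the first two off this
    cycle. *)
Lemma cycle_linkage (A : sgraph) (a a' : A) (w : seq (graph_join A H)) :
  1 < m -> adj (v 0) (v m) -> a != a' -> walk (inl a : graph_join A H) w (inl a') ->
  (forall n, n <= m -> (inr (v n) : graph_join A H) \notin w) ->
  linkage 5 K5_edge (graph_join A H).
Proof.
move=> m1 a0m aa' aw wv.
pose r n : graph_join A H := inr (v n).
have inr_adj (x y : H) : adj x y -> adj (inr x : graph_join A H) (inr y) by [].
pose pos n := nth 0 [:: 0; 0; 1; m; 0] n.
(* Positions on the cycle used by each path; here the starting position is included whenever it lies
   on the cycle. *)
pose idx n n' :=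
  match n, n' with
  | 2, 3 => 1 :: iota 2 (m - 1)
  | 2, 4 => [:: 1; 0]
  | 3, 4 => [:: m; 0]
  | _, _ => [:: pos n']
  end.
pose b n := match n with 0 => inl a : graph_join A H | 1 => inl a' | _ => r (pos n) end.
pose w' n n' :=
  match n, n' with 0, 1 => w | 2, 3 => map r (iota 2 (m - 1)) | _, _ => [:: b n'] end.
have idx_le n n' : n < n' < 5 -> (n' == 1) = false -> {in idx n n', forall x, x <= m}.
  case/andP=> + n5; case: n' n5 => [|[|[|[|[|n']]]]] // _; case: n => [|[|[|[|n]]]] // _ _ x;
    rewrite /idx /pos /= !inE ?mem_iota; lia.
(* A vertex of one of the paths is on [w] and off the cycle, or is [a], or is [a'], or is on the
   cycle at a position listed in [idx]. *)
have shape n n' z : n < n' < 5 -> z \in b n :: w' n n' ->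
  [\/ n' == 1 /\ (forall x, x <= m -> z <> r x), n = 0 /\ z = inl a, n = 1 /\ z = inl a' |
     (n' == 1) = false /\ exists2 x, x \in idx n n' & z = r x].
{ case: (eqVneq n' 1) => [-> |n'1].
    case: n => // _ zw; constructor 1; split=> // x xm zx.
    by case/predU1P: zw; rewrite zx // => zw; have /negP := wv _ xm; apply.
  case/andP=> + n5; case: n' n5 n'1 => [|[|[|[|[|n']]]]] // _ _; case: n => [|[|[|[|n]]]] // _.
  all: case/predU1P => [->|]; try (by constructor 2); try (by constructor 3).
  all: try by [constructor 4; split=> //; exists 1; rewrite ?inE ?eqxx ?orbT
    | constructor 4; split=> //; exists m; rewrite ?inE ?eqxx ?orbT].
  all: try by [case/predU1P => [->|//]; constructor 4; split=> //; exists 1; rewrite ?inE ?eqxx ?orbT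
    | case/predU1P => [->|//]; constructor 4; split=> //; exists m; rewrite ?inE ?eqxx ?orbT
    | case/predU1P => [->|//]; constructor 4; split=> //; exists 0; rewrite ?inE ?eqxx ?orbT].
  by case/mapP => x xi ->; constructor 4; split=> //; exists x; rewrite ?inE ?xi ?orbT. }
apply: (@linkage_K5 (graph_join A H) b w').
- move=> n n' /andP[+ n5]; case: n' n5 => [|[|[|[|[|n']]]]] // _; case: n => [|[|[|[|n]]]] // _;
    rewrite /b /r /pos /=; apply/eqP => //; case; try (by move/eqP: aa'); move/vI; lia.
- move=> n n' /andP[+ n5]; case: n' n5 => [|[|[|[|[|n']]]]] // _; case: n => [|[|[|[|n]]]] // _.
  all: try by apply: walk1; rewrite /b /r /pos /= 1?adj_sym // ?vE //; lia.
  rewrite /w' (_ : map r _ = map inr (stretch 1 m)); last by rewrite /stretch -map_comp.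
  rewrite /b /r /pos /=.
  by apply: walk_map => //; apply: stretch_walk; lia.
move=> n n' k k' nn' kk' U nk z /(shape _ _ _ nn') zn /(shape _ _ _ kk') zk.
have kk1 : k' != 1 by move: kk'; rewrite /K5_edge; lia.
case: zk => [[k1]|[k0]|[k1 zk]|[k1 [y yk zy]]]; first by rewrite k1 in kk1.
- by rewrite k0 ltn0 in nk.
- case: zn => [[n1 zn]|[n0 zn]|[n1]|[n1 [x xn zx]]].
  + by move: U; rewrite k1 (eqP n1) /= andbF.
  + by move/eqP: aa'; apply; move: zn; rewrite zk => -[].
  + by rewrite n1 k1 in nk.
  + by rewrite zk in zx.
have ym := idx_le _ _ kk' k1 y yk.
case: zn => [[n1 zn]|[n0 zn]|[n1 zn]|[n1 [x xn zx]]].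
- exact: zn ym zy.
- by rewrite zn in zy.
- by rewrite zn in zy.
have xm := idx_le _ _ nn' n1 x xn.
have xy : x = y by apply: vI => //; move: zx; rewrite zy => -[].
rewrite -{}xy {y ym zy} in yk; move: nn' kk' nk n1 k1 xn yk U => /andP[+ n5] /andP[+ k5].
case: n' n5 => [|[|[|[|[|n']]]]] // _; case: n => [|[|[|[|n]]]] // _;
  case: k' k5 {kk1} => [|[|[|[|[|k']]]]] // _; case: k => [|[|[|[|k]]]] // _ _ _ _;
  rewrite /idx /pos /= !inE ?mem_iota; lia.
Qed.
End Apex.

(** * Longest paths *)

Section LongestPath.
Variable H : sgraph.
Implicit Types (v : nat -> H) (m n : nat) (S : {set H}).

Definition simple_path v m : Prop :=
  (forall n, n < m -> adj (v n) (v n.+1)) /\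
  (forall n n', n <= m -> n' <= m -> v n = v n' -> n = n').

(** These are the unions of connected components. *)
Definition adj_closed S : Prop := forall x y : H, x \in S -> adj x y -> y \in S.

Definition longest_path S v m : Prop :=
  [/\ simple_path v m, v 0 \in S &
      forall v' m', simple_path v' m' -> v' 0 \in S -> m' <= m].

Lemma simple_path_lt v m : simple_path v m -> m < #|H|.
Proof.
case=> _ vI; rewrite -[m.+1]card_ord.
apply: (@leq_card _ _ (fun i : 'I_m.+1 => v i)) => i j /vI ij.
by apply: ord_inj; apply: ij; rewrite -ltnS.
Qed.

Lemma longest_path_exists S x : x \in S -> exists v m, longest_path S v m.
Proof.
move=> xS; pose P m := `[< exists v, simple_path v m /\ v 0 \in S >].
have P0 : exists m, P m.
  exists 0; apply/asboolP; exists (fun=> x); split=> //.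
  by split=> // n n'; rewrite !leqn0 => /eqP-> /eqP->.
have Pb m : P m -> m <= #|H|.
  by move=> /asboolP[v [/simple_path_lt/ltnW]].
case: (ex_maxnP P0 Pb) => m /asboolP[v [vm v0]] mmax; exists v, m; split=> //.
by move=> v' m' vm' v0'; apply: mmax; apply/asboolP; exists v'.
Qed.

(** A neighbour of the first vertex off the path could be put in front of it, giving a longer
    path. *)
Lemma longest_path_nbr S v m y : adj_closed S -> longest_path S v m ->
  adj (v 0) y -> exists n, [/\ 0 < n, n <= m & y = v n].
Proof.
move=> Sc [[vE vI] v0 vmax] v0y; apply: contrapT => off.
have ny n : n <= m -> y <> v n.
  case: n => [_ yv|n nm yv]; first by rewrite yv adj_irr in v0y.
  by apply: off; exists n.+1.
suff : m.+1 <= m by rewrite ltnn.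
apply: (vmax (fun n => if n is n'.+1 then v n' else y)); last exact: Sc v0y.
split=> [[_|n nm]|[|n] [|n'] // nm nm'].
- by rewrite adj_sym.
- exact: vE.
- by move=> /ny; case.
- by move=> /esym/ny; case.
by move=> /vI ->.
Qed.

Lemma third_nbr (x a b : H) : 2 < deg x -> exists y, [/\ adj x y, y != a & y != b].
Proof.
move=> d3; have : 0 < #|[set y | adj x y] :\: [set a; b]|.
  rewrite cardsD subn_gt0; apply: leq_ltn_trans d3.
  apply: leq_trans (subset_leq_card (subsetIr _ _)) _.
  by rewrite cards2; case: (_ != _).
by case/card_gt0P => y; rewrite !inE negb_or => /andP[/andP[ya yb] xy]; exists y.
Qed.

(** Let i > 1 be least such that some longest path has an edge from [v 0] to [v i]. By minimality a
    third neighbour of [v 0] lies beyond [v i], and so does a third neighbour of [v i.-1], which is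
    the first vertex of another longest path. These chords suit [crossing_chords_linkage]. *)
Lemma min_deg3_linkage (A : sgraph) (a : A) : 0 < #|H| ->
  (forall x : H, 2 < deg x) -> linkage 5 K5_edge (graph_join A H).
Proof.
move=> /card_gt0P[x0 _] d3.
pose P i := `[< 1 < i /\ exists v m, [/\ longest_path [set: H]%SET v m, i <= m & adj (v 0) (v i)] >].
have Tc : adj_closed [set: H]%SET by move=> x y _ _; rewrite inE.
have exP : exists i, P i.
  have [v [m vm]] := longest_path_exists (finset.in_setT x0).
  have [y [v0y y1 _]] := third_nbr (v 1) (v 1) (d3 (v 0)).
  have [n [n0 nm yn]] := longest_path_nbr Tc vm v0y.
  exists n; apply/asboolP; split; last by exists v, m; rewrite -yn.
  by case: n n0 yn {nm} => [|[|n]] // _ yn; rewrite yn eqxx in y1.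
case: (ex_minnP exP) => i /asboolP[i1 [v [m [vm im v0i]]]] imin.
have [[vE vI] _ vmax] := vm.
have [j [ij jm v0j]] : exists j, [/\ i < j, j <= m & adj (v 0) (v j)].
  have [y [v0y y1 yi]] := third_nbr (v 1) (v i) (d3 (v 0)).
  have [n [n0 nm yn]] := longest_path_nbr Tc vm v0y.
  exists n; split; rewrite -?yn // ltn_neqAle.
  have -> : i != n by apply: contraNneq yi => ->; rewrite yn.
  apply: imin; apply/asboolP; split; last by exists v, m; rewrite -yn.
  by case: n n0 yn {nm} => [|[|n]] // _ yn; rewrite yn eqxx in y1.
(* The rotation of the path at [i] starts at [v i.-1] and is longest as well. *)
pose v' n := if n < i then v (i.-1 - n) else v n.
have vm' : longest_path [set: H]%SET v' m.
  split; rewrite ?inE //; split.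
    move=> n nm; rewrite /v'; case: (ltnP n.+1 i) => [ni|].
      rewrite (ltnW ni) adj_sym (_ : i.-1 - n = (i.-1 - n.+1).+1) ?vE //; lia.
    rewrite leq_eqVlt => /orP[/eqP ni|ni].
      by rewrite -ni ni ltnSn subnn -ni.
    by rewrite ltnNge -ltnS ni /= vE.
  move=> n n' nm nm'; rewrite /v'; case: ltnP => ni; case: ltnP => ni' /vI; lia.
have v'0 : v' 0 = v i.-1 by rewrite /v' subn0 ltnW.
have [l [il lm vil]] : exists l, [/\ i < l, l <= m & adj (v i.-1) (v l)].
  have [y [v0y yi2 yi]] := third_nbr (v i.-2) (v i) (d3 (v' 0)).
  have [n [n0 nm yn]] := longest_path_nbr Tc vm' v0y.
  exists n.
  have [ni|] := ltnP n i; last rewrite leq_eqVlt => /orP[/eqP ni|ni]; last 2 first.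
  - by case/eqP: yi; rewrite yn /v' -ni ltnn.
  - by split=> //; rewrite -v'0 (_ : v n = y) // yn /v' ltnNge ltnW.
  have n1 : n != 1.
    apply: contraNneq yi2 => n1; rewrite yn /v' n1 i1.
    by apply/eqP; congr v; lia.
  have : i <= n.
    apply: imin; apply/asboolP; split; first by lia.
    by exists v', m; rewrite -yn.
  by rewrite leqNgt ni.
by apply: (crossing_chords_linkage vE vI a (i := i) (j := j) (l := l)) => //; lia.
Qed.
End LongestPath.

(** * Decomposition of regular graphs of degree one and two *)

Definition cyclic_succ r i := if i.+1 == r then 0 else i.+1.

Definition cyclic_adj r i j : bool :=
  (i != j) && ((cyclic_succ r i == j) || (cyclic_succ r j == i)).

Lemma cycle_adjE r (i j : 'I_r) : cycle_adj i j = cyclic_adj r i j.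
Proof. by rewrite /cycle_adj /cyclic_adj /cyclic_succ -!val_ordS. Qed.

Lemma flatten_nth_inj (T : eqType) (x0 : T) (cs : seq (seq T)) i i' j j' :
  uniq (flatten cs) -> i < size cs -> i' < size cs ->
  j < size (nth [::] cs i) -> j' < size (nth [::] cs i') ->
  nth x0 (nth [::] cs i) j = nth x0 (nth [::] cs i') j' -> i = i' /\ j = j'.
Proof.
elim: cs i i' => [|c cs IH] [|i] [|i'] //=; rewrite cat_uniq => /and3P[uc /hasPn dis ucs].
- move=> _ _ jc jc' /eqP; rewrite nth_uniq // => /eqP ->.
  by [].
- move=> _ i's jc j'c E; have /dis/negP[] : nth x0 c j \in flatten cs; last exact: mem_nth.
  by rewrite E; apply/flattenP; exists (nth [::] cs i'); exact: mem_nth.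
- move=> i's _ jc j'c E; have /dis/negP[] : nth x0 c j' \in flatten cs; last exact: mem_nth.
  by rewrite -E; apply/flattenP; exists (nth [::] cs i); exact: mem_nth.
by rewrite !ltnS => ? ? ? ? /IH[] // -> ->.
Qed.

Section CycleDecomposition.
Variables (H : sgraph) (d : nat).
Hypothesis d12 : d = 1 \/ d = 2.
Hypothesis degH : forall x : H, deg x = d.

(* For [d = 1] the components are single edges, seen as cycles of length 2. *)
Definition cycle_component (c : seq H) : Prop :=
  [/\ uniq c, d < size c, d = 1 -> size c = 2,
    forall x0 i j, i < size c -> j < size c ->
      adj (nth x0 c i) (nth x0 c j) = cyclic_adj (size c) i j &
    forall x y, x \in c -> adj x y -> y \in c].

(** A longest path closes up. Its first vertex has a neighbour [v n], with n > 1 if d = 2; for n < m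
    the neighbours [v 0], [v n.-1] and [v n.+1] would give [v n] a degree above d. Hence n = m, and
    the degrees leave no room for further edges. *)
Lemma cycle_component_exists (S : {set H}) x : adj_closed S -> x \in S ->
  exists2 c, cycle_component c & {subset c <= S}.
Proof.
move=> Sc /longest_path_exists[v [m vm]]; have [[vE vI] v0 _] := vm.
have nbrs (y : H) : #|[set z | adj y z]| = d by exact: degH.
have vS n : n <= m -> v n \in S.
  by elim: n => // n IH nm; apply: Sc (IH (ltnW nm)) (vE _ nm).
have [n [n0 nm v0n]] : exists n, [/\ 0 < n, n <= m & adj (v 0) (v n) /\ n.+1 >= d.+1].
  case: d12 => d1.
    have /card_gt0P[y] : 0 < #|[set z | adj (v 0) z]| by rewrite nbrs d1.
    rewrite inE => v0y; have [n [n0 nm yn]] := longest_path_nbr Sc vm v0y.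
    by exists n; rewrite d1 -yn !ltnS.
  have /card_gt0P[y] : 0 < #|[set z | adj (v 0) z] :\ v 1|.
    by have := nbrs (v 0); rewrite (cardsD1 (v 1)) d1; case: (_ \in _); lia.
  rewrite !inE => /andP[y1 v0y]; have [n [n0 nm yn]] := longest_path_nbr Sc vm v0y.
  exists n; rewrite d1 -yn; split=> //; split=> //.
  by case: n n0 yn {nm} => [|[|n]] // _ yn; rewrite yn eqxx in y1.
case: v0n => v0n nd.
have Hnm : n = m.
  apply/eqP; rewrite eqn_leq nm leqNgt; apply/negP => nm'.
  have sub : [set v 0; v n.-1; v n.+1] \subset [set z | adj (v n) z].
    apply/fintype.subsetP => z; rewrite !inE => /orP[/orP[]|] /eqP ->.
    - by rewrite adj_sym.
    - by rewrite adj_sym -[X in adj _ (v X)](prednK n0) vE // prednK.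
    - exact: vE.
  have := subset_leq_card sub; rewrite nbrs -finset.setUA cardsU1 cards2 !inE.
  have E k l : k <= m -> l <= m -> (v k == v l) = (k == l).
    by move=> km lm; apply/eqP/eqP => [|->] //; exact: vI.
  by rewrite !E; lia.
(* The cyclic predecessor, with m before 0. For d = 1 it coincides with the cyclic successor. *)
subst n; pose cp i := if i is i'.+1 then i' else m.
have vN i (y : H) : i <= m -> adj (v i) y = (y == v (cyclic_succ m.+1 i)) || (y == v (cp i)).
  move=> im; have -> : adj (v i) y = (y \in [set z | adj (v i) z]) by rewrite inE.
  suff -> : [set z | adj (v i) z] = [set v (cyclic_succ m.+1 i); v (cp i)].
    by rewrite !inE.
  apply/esym/eqP; rewrite eqEcard nbrs; apply/andP; split.
    apply/fintype.subsetP => z; rewrite !inE /cyclic_succ => /orP[] /eqP ->.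
      case: eqP => [[->]|ne]; first by rewrite adj_sym.
      by apply: vE; lia.
    case: i im => [|i] im //=; rewrite adj_sym; exact: vE.
  rewrite cards2; case: d12 => d1; first by rewrite d1; case: (_ != _).
  suff -> : v (cyclic_succ m.+1 i) != v (cp i) by rewrite d1.
  apply/eqP => /vI; rewrite /cyclic_succ; case: eqP; case: i im => [|i] /=; lia.
have size_c : size (mkseq v m.+1) = m.+1 by rewrite size_mkseq.
exists (mkseq v m.+1); last first.
  by move=> y /mapP[n]; rewrite mem_iota add0n ltnS => /andP[_ nm1] ->; exact: vS.
split; rewrite ?size_c //.
- by rewrite map_inj_in_uniq ?iota_uniq // => i j; rewrite !mem_iota !add0n !ltnS /= => im jm /vI ->.
- move=> d1; congr _.+1; apply/eqP; rewrite eqn_leq n0 andbT leqNgt; apply/negP => m1.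
  have sub : [set v 0; v 2] \subset [set z | adj (v 1) z].
    apply/fintype.subsetP => z; rewrite !inE => /orP[] /eqP ->; last exact: vE.
    by rewrite adj_sym vE.
  have := subset_leq_card sub; rewrite nbrs cards2 d1.
  by case: eqP => // /vI; lia.
- move=> x0 i j im jm; rewrite !nth_mkseq // vN //.
  have E k l : k <= m -> l <= m -> (v k == v l) = (k == l).
    by move=> km lm; apply/eqP/eqP => [|->] //; exact: vI.
  have cpm : cp i <= m by rewrite /cp; case: (i) im; lia.
  have csm : cyclic_succ m.+1 i <= m by rewrite /cyclic_succ; case: eqP; lia.
  rewrite !E //; rewrite /cyclic_adj /cyclic_succ /cp {cpm csm}.
  case: (i.+1 =P m.+1); case: (j.+1 =P m.+1); by case: i im => [|i] im; lia.
move=> y z /mapP[i]; rewrite mem_iota add0n ltnS => /andP[_ im] ->.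
rewrite vN // => /orP[] /eqP ->; apply/map_f; rewrite mem_iota add0n ltnS leq0n /=.
  by rewrite /cyclic_succ; case: eqP; lia.
by rewrite /cp; case: i im => [|i] im; lia.
Qed.


Lemma cycle_decomposition (S : {set H}) : adj_closed S ->
  exists cs : seq (seq H), [/\ uniq (flatten cs), flatten cs =i S &
    forall c, c \in cs -> cycle_component c].
Proof.
have [n] := ubnP #|S|; elim: n S => // n IH S Sn Sc.
have [->|[x xS]] := set_0Vmem S.
  by exists [::]; split=> [|x|c] //=; rewrite ?finset.in_set0 ?in_nil.
have [c [uc dc d1 cadj cclosed] cS] := cycle_component_exists Sc xS.
have [||cs [ucs csE csP]] := IH (S :\: [set y in c]).
- rewrite -ltnS; apply: leq_trans Sn; rewrite ltnS; apply: proper_card.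
  case: c dc {uc d1 cadj cclosed} cS => // y c _ cS.
  apply/properP; split; first exact: subsetDl.
  by exists y; [apply: cS; rewrite mem_head|rewrite !inE eqxx].
- move=> y z; rewrite !inE => /andP[yc yS] yz; rewrite (Sc _ _ yS yz) andbT.
  by apply: contra yc => /cclosed; apply; rewrite adj_sym.
exists (c :: cs); split.
- rewrite /= cat_uniq uc ucs andbT; apply/hasPn => y.
  by rewrite csE !inE => /andP[].
- move=> y; rewrite /= mem_cat csE !inE.
  by have [/cS ->|] := boolP (y \in c).
by move=> c'; rewrite inE => /orP[/eqP->|/csP].
Qed.

Lemma regular12_cycles : 0 < #|H| -> exists m (c : 'I_m -> nat),
  [/\ 0 < m, forall i, d < c i, d = 1 -> forall i, c i = 2 &
    isomorphic H (disjoint_union (fun i : 'I_m => cycle_graph (c i)))].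
Proof.
move=> /card_gt0P[x0 _].
have [|cs [ucs csE csP]] := @cycle_decomposition [set: H]%SET; first by move=> x y; rewrite !inE.
have compP i : i < size cs -> cycle_component (nth [::] cs i) by move=> ics; apply/csP/mem_nth.
exists (size cs), (fun i => size (nth [::] cs i)); split.
- case: cs csE {ucs csP compP} => // /(_ x0); by rewrite finset.in_setT in_nil.
- by move=> i; have [] := compP i (ltn_ord i).
- by move=> d1 i; have [] := compP i (ltn_ord i) => _ _ /(_ d1).
apply: isomorphic_sym.
pose D := disjoint_union (fun i : 'I_(size cs) => cycle_graph (size (nth [::] cs i))).
pose g (u : D) : H := nth x0 (nth [::] cs (tag u : 'I_(size cs))) (tagged u : 'I_(size (nth [::] cs (tag u)))).
have gI : injective g.
  move=> [i j] [i' j'] /(flatten_nth_inj ucs (ltn_ord i) (ltn_ord i') (ltn_ord j) (ltn_ord j')) /= [/ord_inj ii' jj'].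
  by case: _ / ii' j' jj' => j' /ord_inj ->.
have /choice[h hK] : forall y, exists u, g u = y.
  move=> y; have /flattenP[c /(nthP [::])[i ics <-] /(nthP x0)[j jc <-]] : y \in flatten cs.
    by rewrite csE inE.
  by exists (existT (fun i : 'I_(size cs) => 'I_(size (nth [::] cs i))) (Ordinal ics) (Ordinal jc)).
exists g; split; first by exists h => // u; apply: gI; rewrite hK.
move=> [i j] [i' j']; rewrite /= /dunion_adj /=.
have [_ _ _ cadj cclosed] := compP i (ltn_ord i).
case: eqP => [ii'|ii'] /=.
  by case: _ / ii' j' => j'; rewrite tagged_asE /g /= cadj // -cycle_adjE.
apply: contra_notF ii' => gg; have := cclosed _ _ (mem_nth _ (ltn_ord j)) gg.
case/(nthP x0) => k kc /(flatten_nth_inj ucs (ltn_ord i) (ltn_ord i') kc (ltn_ord j'))[ii' _].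
exact: ord_inj.
Qed.
End CycleDecomposition.

(** * Structure of graphs with alpha_ir = 1 *)

(** Each degree class is completely joined to its complement. If some complement has at most two
    vertices, it is the required set, nonempty as G is not regular. Otherwise the absence of K33
    bounds every class by two vertices, so only the degrees [#|G|] - 1 and [#|G|] - 2 occur; then
    the complement of a class lies in a single class and has at most two vertices after all. *)
Lemma irregular_split (G : sgraph) : 0 < #|G| -> ~ regular G ->
  (forall x y : G, deg x != deg y -> adj x y) -> ~ linkage 6 K33_edge G ->
  exists A : {set G}, [/\ #|A| = 1 \/ #|A| = 2, 0 < #|~: A|,
    {in A & ~: A, forall x y, adj x y} & exists d, {in ~: A, forall x, deg x = d}].
Proof.
move=> /card_gt0P[x0 _] nreg dadj nK33.
pose cls (x : G) : {set G} := [set y | deg y == deg x].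
have clsP x y : x \in ~: cls y -> forall z, z \in cls y -> adj x z.
  by rewrite !inE => xy z; rewrite inE => /eqP zy; apply: dadj; rewrite zy.
have [[x xs]|big] := pselect (exists x, #|~: cls x| <= 2).
  exists (~: cls x); rewrite finset.setCK; split.
  - move: xs; case E : #|_| => [|[|[|]]] //; auto; case: nreg; exists (deg x) => y.
    by have /eqP := E; rewrite cards_eq0 => /eqP/setP/(_ y); rewrite !inE => /negbFE/eqP.
  - by apply/card_gt0P; exists x; rewrite inE.
  - by move=> y z /clsP; apply.
  by exists (deg x) => y; rewrite inE => /eqP.
have small x : #|cls x| <= 2.
  rewrite leqNgt; apply/negP => xb; apply: nK33; apply: (@linkage_K33 _ (cls x) (~: cls x)) => //.
    by rewrite ltnNge; apply/negP => ?; apply: big; exists x.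
  by move=> y z yx /clsP zx; rewrite adj_sym; exact: zx.
have degle (x : G) : deg x < #|G|.
  rewrite /deg -[X in _ < X]cardsT; apply: proper_card; apply/properP; split; first exact: finset.subsetT.
  by exists x; rewrite !inE ?adj_irr.
have degge (x : G) : #|G| <= (deg x).+2.
  rewrite -(cardsC (cls x)) -addn2 addnC leq_add ?small //.
  by apply: subset_leq_card; apply/fintype.subsetP => y /clsP yx; rewrite inE adj_sym yx // inE.
have /card_gt0P[y yx] : 0 < #|~: cls x0|.
  by rewrite ltnNge leqn0; apply/negP => /eqP E; apply: big; exists x0; rewrite E.
case: big; exists x0; apply: leq_trans (small y); apply: subset_leq_card.
apply/fintype.subsetP => z; move: yx; rewrite !inE.
by have := degle x0; have := degge x0; have := degle y; have := degge y; have := degle z; have := degge z; lia.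
Qed.

(** * Induced subgraphs and isomorphisms with the graphs of the list *)

Section Induced.
Variables (G : sgraph) (A : {set G}).

Definition induced_adj : rel {x : G | x \in A} := fun u v => adj (val u) (val v).
Lemma induced_adj_sym : symmetric induced_adj.
Proof. by move=> u v; exact: adj_sym. Qed.
Lemma induced_adj_irr : irreflexive induced_adj.
Proof. by move=> u; exact: adj_irr. Qed.
Definition induced_graph : sgraph := SGraph induced_adj_sym induced_adj_irr.

Lemma card_induced : #|induced_graph| = #|A|.
Proof. by rewrite card_sig; apply: eq_card => x; rewrite inE. Qed.
End Induced.

Lemma isomorphic_join_induced (G : sgraph) (A : {set G}) :
  {in A & ~: A, forall x y, adj x y} ->
  isomorphic (graph_join (induced_graph A) (induced_graph (~: A))) G.
Proof.
move=> AB.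
pose f (u : graph_join (induced_graph A) (induced_graph (~: A))) : G :=
  match u with inl x => val x | inr y => val y end.
have NA (x : induced_graph A) (y : induced_graph (~: A)) : val x <> val y.
  by move=> xy; have := valP y; rewrite -xy inE (valP x).
have fI : injective f.
  by move=> [u|u] [v|v] /= => [/val_inj->|/NA|/esym/NA|/val_inj->].
exists f; split.
  apply: inj_card_bij fI _.
  by rewrite card_sum !card_induced cardsC.
move=> [u|u] [v|v] //=.
  by rewrite AB ?(valP u) ?(valP v).
by rewrite adj_sym AB ?(valP u) ?(valP v).
Qed.

Lemma deg_induced_setC (G : sgraph) (A : {set G}) (y : induced_graph (~: A)) :
  {in A & ~: A, forall x y, adj x y} -> deg (val y) = #|A| + deg y.
Proof.
move=> AB; rewrite /deg -(cardsID A); congr addn.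
  apply: eq_card => x; rewrite !inE; have [xA|] := boolP (x \in A); last by rewrite andbF.
  by rewrite andbT adj_sym AB ?(valP y).
rewrite -(card_imset _ val_inj); apply: eq_card => x.
apply/idP/imsetP => [|[z]]; last first.
  by rewrite inE => yz ->; have := valP z; rewrite !inE => ->; exact: yz.
rewrite !inE => /andP[xA yx]; have xC : x \in ~: A by rewrite inE.
by exists (Sub x xC); rewrite // inE.
Qed.

Lemma isomorphic_join (A A' B B' : sgraph) : isomorphic A A' -> isomorphic B B' ->
  isomorphic (graph_join A B) (graph_join A' B').
Proof.
move=> [f [[f' fK f'K] fadj]] [g [[g' gK g'K] gadj]].
exists (fun u => match u with inl x => inl (f x) | inr y => inr (g y) end); split.
  exists (fun u => match u with inl x => inl (f' x) | inr y => inr (g' y) end).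
    by case=> x; rewrite ?fK ?gK.
  by case=> x; rewrite ?f'K ?g'K.
by case=> x [] y /=.
Qed.

(** When adjacency depends on equality alone, as in [complete] and [edgeless], every bijection is an
    isomorphism. *)
Lemma isomorphic_const (H : sgraph) n (e : rel 'I_n) se ie : #|H| = n ->
  (forall x y : H, forall i j, (x == y) = (i == j) -> adj x y = e i j) ->
  isomorphic H (@SGraph 'I_n e se ie).
Proof.
move=> Hn He; exists (fun x => cast_ord Hn (enum_rank x)); split.
  exists (fun i => enum_val (cast_ord (esym Hn) i)) => x.
    by rewrite cast_ordK enum_rankK.
  by rewrite enum_valK cast_ordKV.
by move=> x y /=; apply/esym/He; rewrite (inj_eq (@cast_ord_inj _ _ _)) (inj_eq enum_rank_inj).
Qed.

Lemma isomorphic_complete (H : sgraph) n : #|H| = n ->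
  (forall x y : H, adj x y = (x != y)) -> isomorphic H (complete n).
Proof. by move=> Hn He; apply: isomorphic_const => // x y i j xy; rewrite He xy. Qed.

Lemma isomorphic_edgeless (H : sgraph) n : #|H| = n ->
  (forall x y : H, adj x y = false) -> isomorphic H (edgeless n).
Proof. by move=> Hn He; apply: isomorphic_const => // x y i j xy; rewrite He. Qed.

Lemma two_vertices (H : sgraph) : #|H| = 2 ->
  isomorphic H (complete 2) \/ isomorphic H (edgeless 2).
Proof.
move=> H2; have [[x [y xy]]|none] := pselect (exists x y : H, adj x y).
  left; apply: isomorphic_complete => // u v.
  have xny : x != y by apply: contraTneq xy => ->; rewrite adj_irr.
  have E z : (z == x) || (z == y).
    have /eqP/setP/(_ z) : [set x; y] == [set: H]%SET.
      by rewrite eqEcard finset.subsetT cardsT H2 cards2 xny.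
    by rewrite !inE.
  case/orP: (E u) => /eqP ->; case/orP: (E v) => /eqP ->; rewrite ?eqxx ?adj_irr //.
    by rewrite xy xny.
  by rewrite adj_sym xy eq_sym xny.
right; apply: isomorphic_edgeless => // u v; apply/negP => uv.
by apply: none; exists u, v.
Qed.

Lemma regular0_edgeless (H : sgraph) : (forall x : H, deg x = 0) ->
  isomorphic H (edgeless #|H|).
Proof.
move=> d0; apply: isomorphic_edgeless => // x y.
by have /eqP := d0 x; rewrite cards_eq0 => /eqP/setP/(_ y); rewrite !inE.
Qed.

Lemma isomorphic_card (G H : sgraph) : isomorphic G H -> #|G| = #|H|.
Proof. by move=> [f [/bij_eq_card]]. Qed.

Lemma card_copies s (H : sgraph) : #|copies s H| = s * #|H|.
Proof. by rewrite card_tagged sumnE big_map big_enum /= sum_nat_const card_ord. Qed.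

Lemma regular1_copies (H : sgraph) : 0 < #|H| -> (forall x : H, deg x = 1) ->
  ~~ odd #|H| /\ isomorphic H (copies #|H|./2 (complete 2)).
Proof.
move=> H0 d1; have [m [c [m0 _ c2 iso]]] := regular12_cycles (or_introl erefl) d1 H0.
have {c2}cE : c = fun=> 2 by apply/funext => i; exact: c2.
subst c; have {}iso : isomorphic H (copies m (complete 2)).
  apply: isomorphic_trans iso _; apply: isomorphic_eq_adj => -[i j] [i' j'].
  rewrite /dunion_adj /=; case: eqP => //= ii'; case: _ / ii' j' => j'.
  rewrite !tagged_asE /= cycle_adjE -val_eqE /=.
  by case: j j' => [[|[|]] ?] // [[|[|]] ?].
by rewrite (isomorphic_card iso) card_copies card_ord muln2 odd_double doubleK.
Qed.

Lemma regular2_cycles (H : sgraph) : 0 < #|H| -> (forall x : H, deg x = 2) ->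
  exists m (c : 'I_m -> nat), [/\ 0 < m, forall i, 2 < c i &
    isomorphic H (disjoint_union (fun i : 'I_m => cycle_graph (c i)))].
Proof.
move=> H0 d2; have [m [c [m0 c2 _ iso]]] := regular12_cycles (or_intror erefl) d2 H0.
by exists m, c.
Qed.

Lemma isomorphic_single_cycle (c : 'I_1 -> nat) :
  isomorphic (disjoint_union (fun i : 'I_1 => cycle_graph (c i))) (cycle_graph (c ord0)).
Proof.
apply: isomorphic_sym.
exists (fun j : 'I_(c ord0) => existT (fun i : 'I_1 => 'I_(c i)) ord0 j); split.
  exists (fun u : {i : 'I_1 & 'I_(c i)} => let: existT i j := u in
    cast_ord (f_equal c (ord1 i)) j).
    by move=> j /=; apply: ord_inj.
  move=> [i j] /=; move: j; rewrite (ord1 i) => j; congr existT; exact: ord_inj.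
by move=> i j; rewrite /= /dunion_adj /= tagged_asE.
Qed.

Lemma bipartite_isomorphic_join p q :
  isomorphic (complete_bipartite p q) (graph_join (edgeless p) (edgeless q)).
Proof. by apply: isomorphic_eq_adj => -[i|i] [j|j]. Qed.

Lemma cycle_of_component m (c : 'I_m -> nat) (i : 'I_m) : 2 < c i ->
  let D := disjoint_union (fun i : 'I_m => cycle_graph (c i)) in
  exists v : nat -> D,
  [/\ simple_path v (c i).-1, adj (v 0) (v (c i).-1) & forall n, tag (v n) = i].
Proof.
move=> ci D; have c0 : 0 < c i by lia.
(* Indices from [c i] on are sent to position 0 of the same cycle, which keeps the tag equal to i
   for every n. *)
pose v n : D := existT (fun i : 'I_m => 'I_(c i)) i (insubd (Ordinal c0) n).
have vv n : n < c i -> insubd (Ordinal c0) n = n :> nat.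
  by move=> nc; rewrite (val_insubd (Ordinal c0) n) nc.
have vadj n n' : adj (v n) (v n') = cyclic_adj (c i) (insubd (Ordinal c0) n) (insubd (Ordinal c0) n').
  by rewrite /= /dunion_adj /= eqxx tagged_asE -cycle_adjE.
exists v; split=> //; first split.
- move=> n nc; rewrite vadj !vv /cyclic_adj /cyclic_succ; try lia.
  by case: (n.+1 =P c i); lia.
- move=> n n' nc n'c /eqP; rewrite -tag_eqE /tag_eq eqxx tagged_asE => /eqP.
  by move/(congr1 (@nat_of_ord _)); rewrite /= !vv; lia.
rewrite vadj !vv /cyclic_adj /cyclic_succ; try lia.
by case: (1 =P c i); case: ((c i).-1.+1 =P c i); lia.
Qed.

(** * Nonplanar joins *)

Section Nonplanar.
Variables (R : realType) (G : sgraph).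

Lemma cone_min_deg3_nonplanar (A H : sgraph) : 0 < #|A| -> 0 < #|H| ->
  (forall x : H, 2 < deg x) -> isomorphic G (graph_join A H) -> ~ planar R G.
Proof.
move=> /card_gt0P[a _] H0 d3 iso plG; apply: (planar_no_K5 plG).
exact: linkage_isomorphic iso (min_deg3_linkage a H0 d3).
Qed.

Lemma K2_cycles_nonplanar m (c : 'I_m -> nat) : 0 < m -> (forall i, 2 < c i) ->
  isomorphic G (graph_join (complete 2) (disjoint_union (fun i : 'I_m => cycle_graph (c i)))) ->
  ~ planar R G.
Proof.
move=> m0 c3 iso plG; apply: (planar_no_K5 plG); apply: linkage_isomorphic iso _.
have [v [[vE vI] v0 _]] := cycle_of_component (c3 (Ordinal m0)).
apply: (@cycle_linkage _ v _ vE vI (complete 2) ord0 ord_max [:: inl ord_max]) => //.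
  by have := c3 (Ordinal m0); lia.
Qed.

(** The two nonadjacent vertices are linked through a vertex of a second cycle, off the first
    one. *)
Lemma E2_cycles_nonplanar m (c : 'I_m -> nat) : 1 < m -> (forall i, 2 < c i) ->
  isomorphic G (graph_join (edgeless 2) (disjoint_union (fun i : 'I_m => cycle_graph (c i)))) ->
  ~ planar R G.
Proof.
move=> m1 c3 iso plG; apply: (planar_no_K5 plG); apply: linkage_isomorphic iso _.
have m0 : 0 < m by exact: ltnW.
have [v [[vE vI] v0 vt]] := cycle_of_component (c3 (Ordinal m0)).
have [u [_ _ ut]] := cycle_of_component (c3 (Ordinal m1)).
apply: (@cycle_linkage _ v _ vE vI (edgeless 2) ord0 ord_max [:: inr (u 0); inl ord_max]) => //.
  by have := c3 (Ordinal m0); lia.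
move=> n _; rewrite !inE orbF; apply/eqP => -[] /(congr1 tag).
by rewrite vt ut.
Qed.
End Nonplanar.

(** * Both directions of the characterization *)

Lemma join_fan_planar_alpha_ir (R : realType) (G A B : sgraph) (a : A -> bool)
    (g : B -> nat) : 0 < #|G| -> regular A -> regular B -> injective a ->
  double_fan_adj g -> isomorphic G (graph_join A B) -> planar R G /\ alpha_ir G = 1.
Proof.
by move=> G0 rA rB aI gP iso; split;
  [exact: planar_join_fan aI gP iso|exact: join_alpha_ir G0 rA rB iso].
Qed.

Lemma regular_cycles m (c : 'I_m -> nat) : (forall i, 2 < c i) ->
  regular (disjoint_union (fun i : 'I_m => cycle_graph (c i))).
Proof. by move=> c3; apply: (@regular_disjoint_union _ _ 2) => i x; exact: deg_cycle. Qed.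

Lemma regular_copies_K2 s : regular (copies s (complete 2)).
Proof.
have [d dK] := regular_complete 2.
by apply: (@regular_disjoint_union _ _ d) => i x; exact: dK.
Qed.

Theorem theorem3p3 (R : realType) (G : sgraph) (n : nat)
    (n_gt0 : 0 < n) (card_G : #|G| = n) :
  (planar R G /\ alpha_ir G = 1) <->
  ((regular G /\ planar R G) \/
   (2 <= n /\ isomorphic G (complete_bipartite 1 (n - 1))) \/
   (3 <= n /\ isomorphic G (complete_bipartite 2 (n - 2))) \/
   (3 <= n /\ isomorphic G (graph_join (complete 2) (edgeless (n - 2)))) \/
   (4 <= n /\ ~~ odd n /\
     isomorphic G (graph_join (complete 2) (copies (n - 2)./2 (complete 2)))) \/
   (4 <= n /\ ~~ odd n /\
     isomorphic G (graph_join (edgeless 2) (copies (n - 2)./2 (complete 2)))) \/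
   (5 <= n /\
     isomorphic G (graph_join (edgeless 2) (cycle_graph (n - 2)))) \/
   (5 <= n /\ odd n /\ isomorphic G (windmill 3 (n - 1)./2)) \/
   (exists (m : nat) (c : 'I_m -> nat),
     0 < m /\ (forall i, 3 <= c i) /\
     isomorphic G (graph_join (complete 1)
                     (disjoint_union (fun i : 'I_m => cycle_graph (c i)))))).
Proof.
have G0 : 0 < #|G| by rewrite card_G.
split=> [[plG /alpha_ir1P[_ dadj]]|]; last first.
  have bip p : isomorphic G (complete_bipartite p (n - p)) ->
      isomorphic G (graph_join (edgeless p) (edgeless (n - p))).
    by move=> iso; exact: isomorphic_trans iso (bipartite_isomorphic_join _ _).
  have re := regular_edgeless; have rc := regular_complete; have rK := regular_copies_K2.
  have fe := double_fan_edgeless; have fK := double_fan_copies_K2.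
  have i1 := ord1_bool_inj; have i2 := ord2_bool_inj.
  case=> [[rG plG]|]; first by split=> //; exact: regular_alpha_ir.
  case=> [[_ /bip iso]|].
    exact: join_fan_planar_alpha_ir G0 (re 1) (re _) i1 (fe _) iso.
  case=> [[_ /bip iso]|].
    exact: join_fan_planar_alpha_ir G0 (re 2) (re _) i2 (fe _) iso.
  case=> [[_ iso]|].
    exact: join_fan_planar_alpha_ir G0 (rc 2) (re _) i2 (fe _) iso.
  case=> [[_ [_ iso]]|].
    exact: join_fan_planar_alpha_ir G0 (rc 2) (rK _) i2 (fK _) iso.
  case=> [[_ [_ iso]]|].
    exact: join_fan_planar_alpha_ir G0 (re 2) (rK _) i2 (fK _) iso.
  case=> [[n5 iso]|].
    have n3 : 3 <= n - 2 by lia.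
    split; first exact: planar_bipyramid_join n3 iso.
    by apply: join_alpha_ir G0 (re 2) _ iso; exists 2 => x; exact: deg_cycle.
  case=> [[_ [_ iso]]|[m [c [_ [c3 iso]]]]].
    exact: join_fan_planar_alpha_ir G0 (rc 1) (rK _) i1 (fK _) iso.
  split; first exact: planar_cycles_cone iso.
  exact: join_alpha_ir G0 (rc 1) (regular_cycles c3) iso.
have [regG|nreg] := pselect (regular G); first by left.
have [A [A12 B0 AB [e eB]]] := irregular_split G0 nreg dadj (planar_no_K33 plG).
have isoG := isomorphic_sym (isomorphic_join_induced AB).
set IA := induced_graph A in isoG; set H := induced_graph (~: A) in isoG.
have cIA : #|IA| = #|A| by exact: card_induced.
have cH : #|H| = #|~: A| by exact: card_induced.
have nE : #|A| + #|H| = n by rewrite cH cardsC.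
have H0 : 0 < #|H| by rewrite cH.
(* A vertex outside [A] has degree e in G and loses all of [A] when passing to [H]. *)
pose d := e - #|A|.
have dH (y : H) : deg y = d.
  by have := deg_induced_setC y AB; rewrite (eB _ (valP y)) /d => ->; rewrite addKn.
have d3 : d < 3.
  rewrite ltnNge; apply/negP => d3; apply: cone_min_deg3_nonplanar isoG plG => //.
    by rewrite cIA; case: A12 => ->.
  by move=> y; rewrite dH.
have join A' H' : isomorphic IA A' -> isomorphic H H' -> isomorphic G (graph_join A' H').
  by move=> iA iH; apply: isomorphic_trans isoG (isomorphic_join iA iH).
have d_cases : [\/ d = 0, d = 1 | d = 2].
  by case: (d) d3 => [|[|[|]]] // _; [constructor 1|constructor 2|constructor 3].
case: A12 => cA; rewrite cA in nE.
  have A1 e' se ie : isomorphic IA (@SGraph 'I_1 e' se ie).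
    apply: isomorphic_const; first by rewrite cIA.
    move=> x y i j _; have /fintype_le1P E : #|IA| <= 1 by rewrite cIA cA.
    by rewrite (E x y) (ord1 i) (ord1 j) adj_irr ie.
  have nH : n - 1 = #|H| by lia.
  case: d_cases => dE.
  - right; left; split; first by lia.
    rewrite nH; apply: isomorphic_trans (isomorphic_sym (bipartite_isomorphic_join _ _)).
    by apply: join; [exact: A1|apply: regular0_edgeless => y; rewrite dH].
  - have [oH isoH] := regular1_copies H0 (fun y => etrans (dH y) dE).
    do 7! right; left; rewrite -nH in oH isoH; split; last first.
      by split; [lia|apply: join => //; exact: A1].
    (* With two vertices in [H] the graph G would be a triangle, which is regular; since [#|H|] is
       even, excluding this gives 5 <= n for the windmill. *)
    have H2 : #|H| != 2.
      apply/eqP => H2; apply: nreg; exists 2 => x; rewrite -H2.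
      have [xA|xA] := boolP (x \in A).
        rewrite cH; apply: eq_card => z; rewrite !inE.
        have [a Aa] := cards1P (introT eqP cA).
        move: xA; rewrite Aa inE => /eqP xa.
        have [za|za] := eqVneq z a; first by rewrite za xa inE eqxx adj_irr.
        by rewrite inE za AB ?inE ?Aa ?inE ?xa.
      have /card_gt0P[y _] := H0; rewrite (eB x) ?inE //.
      by rewrite -(eB _ (valP y)) (deg_induced_setC y AB) cA dH dE H2.
    by move: H0 H2; rewrite -nH; lia.
  have [m [c [m0 c2 isoH]]] := regular2_cycles H0 (fun y => etrans (dH y) dE).
  by do 8! right; exists m, c; split=> //; split=> //; apply: join => //; exact: A1.
have nH : n - 2 = #|H| by lia.
have IA2 := two_vertices (etrans cIA cA).
case: d_cases => dE.
- have isoH : isomorphic H (edgeless (n - 2)).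
    by rewrite nH; apply: regular0_edgeless => y; rewrite dH.
  have n3 : 3 <= n by lia.
  case: IA2 => isoA; first by do 3! right; left; split=> //; exact: join.
  right; right; left; split=> //.
  by apply: isomorphic_trans (isomorphic_sym (bipartite_isomorphic_join _ _)); exact: join.
- have [oH isoH] := regular1_copies H0 (fun y => etrans (dH y) dE).
  rewrite -nH in oH isoH; have n4 : 4 <= n by lia.
  have on : ~~ odd n by lia.
  case: IA2 => isoA; first by do 4! right; left; split=> //; split=> //; exact: join.
  by do 5! right; left; split=> //; split=> //; exact: join.
(* Two vertices joined to a union of cycles: they cannot be adjacent, and there is just one cycle,
   since otherwise G contains a subdivided K5. *)
have [m [c [m0 c2 isoH]]] := regular2_cycles H0 (fun y => etrans (dH y) dE).
case: IA2 => isoA.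
  by case: (K2_cycles_nonplanar m0 c2 (join _ _ isoA isoH) plG).
have m1 : m = 1.
  apply/eqP; rewrite eqn_leq m0 andbT leqNgt; apply/negP => m1.
  exact: (E2_cycles_nonplanar m1 c2 (join _ _ isoA isoH) plG).
subst m; have isoC := isomorphic_trans isoH (isomorphic_single_cycle c).
have cE : c ord0 = n - 2 by rewrite nH (isomorphic_card isoC) card_ord.
rewrite cE in isoC; do 6! right; left; split; last exact: join.
by have := c2 ord0; lia.
Qed.
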